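(* Let $d\in\mathbb{N}$ and let $p,q\in\mathcal{P}_d(\mathbb{R})$. (1) Every non-trivial root of $p\boxplus_d q$ is simple (has multiplicity one). (2) For every atom triplet $(\alpha,\beta,\alpha+\beta)$ of $(p,q,p\boxplus_d q)$, \[ \mu_{p\boxplus_d q}(\{\alpha+\beta\})=\mu_p(\{\alpha\})+\mu_q(\{\beta\})-1 \quad\text{and}\quad \mathcal{F}_{p\boxplus_d q}(\alpha+\beta)=\mathcal{F}_p(\alpha)+\mathcal{F}_q(\beta)-1 . \]
   Context: $\mathcal{P}_d(\mathbb{C})$ denotes the monic complex polynomials of degree $d$; for $K\subset\mathbb{C}$, $\mathcal{P}_d(K)$ is the set of those whose roots all lie in $K$. For $p(x)=\prod_{i=1}^d(x-\lambda_i)$ write $p(x)=\sum_{k=0}^d(-1)^k\binom{d}{k}\tilde e_k(p)x^{d-k}$, where $\tilde e_k(p)=\binom{d}{k}^{-1}\sum_{i_1<\dots<i_k}\lambda_{i_1}\cdots\lambda_{i_k}$, $\tilde e_0=1$. The finite free additive convolution $p\boxplus_d q$ is the polynomial with $\tilde e_k(p\boxplus_d q)=\sum_{i=0}^k\binom{k}{i}\tilde e_i(p)\tilde e_{k-i}(q)$ for $0\le k\le d$. The empirical root distribution is $\mu_p=\frac1d\sum_{i=1}^d\delta_{\lambda_i}$, and for real-rooted $p$, $\mathcal{F}_p(x)=\mu_p((-\infty,x])$ is its CDF. If $\alpha$ is a root of $p$ of multiplicity $m^p_\alpha$ and $\beta$ a root of $q$ of multiplicity $m^q_\beta$ with $m^p_\alpha+m^q_\beta-d>0$,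 then $\alpha+\beta$ is called a trivial root of $p\boxplus_d q$ and $(\alpha,\beta,\alpha+\beta)$ an atom triplet of $(p,q,p\boxplus_d q)$; roots of $p\boxplus_d q$ that are not trivial roots are called non-trivial. *)

(* Defs.v *)
From HB Require Import structures.
From mathcomp Require Import all_boot all_order all_algebra.
From mathcomp.real_closed Require Import polyrcf complex.
Set Implicit Arguments. Unset Strict Implicit. Unset Printing Implicit Defensive.
Import Order.TTheory GRing.Theory Num.Theory.
Local Open Scope ring_scope.

Section FiniteFree.
Variable R : rcfType.

Definition realrooted_monic (d : nat) (p : {poly R}) : Prop :=
  exists s : seq R, size s = d /\ p = \prod_(x <- s) ('X - x%:P).

(* normalized elementary symmetric coefficient, read off from
   p(x) = sum_k (-1)^k C(d,k) etilde_k(p) x^(d-k) *)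
Definition etilde (d : nat) (p : {poly R}) (k : nat) : R :=
  (-1) ^+ k * p`_(d - k) / ('C(d, k))%:R.

Definition boxplus (d : nat) (p q : {poly R}) : {poly R} :=
  \sum_(k < d.+1)
     (((-1) ^+ k * ('C(d, k))%:R *
       (\sum_(i < k.+1) ('C(k, i))%:R * etilde d p i * etilde d q (k - i)))
        *: 'X^(d - k)).

Definition degp (p : {poly R}) : nat := (size p).-1.

Definition emp_atom (p : {poly R}) (a : R) : R :=
  (mup a p)%:R / (degp p)%:R.

Definition emp_cdf (p : {poly R}) (x : R) : R :=
  (\sum_(r <- rootsR p | r <= x) mup r p)%:R / (degp p)%:R.

Definition atom_triplet (d : nat) (p q : {poly R}) (a b : R) : Prop :=
  root p a /\ root q b /\ (d < mup a p + mup b q)%N.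

Definition trivial_root (d : nat) (p q : {poly R}) (z : R[i]) : Prop :=
  exists a b : R, atom_triplet d p q a b /\ z = (a + b)%:C%C.

End FiniteFree.

(* Main.v *)
Require Import Defs.
From HB Require Import structures.
From mathcomp Require Import all_boot all_order all_algebra.
From mathcomp.real_closed Require Import polyrcf complex.
From mathcomp Require Import ring zify.
Import Order.TTheory GRing.Theory Num.Theory.
Local Open Scope ring_scope.
Set Implicit Arguments.
Unset Strict Implicit.

(* Write p * q for the convolution. For monic q of degree d with roots b_j, the value
   d! (p * q)(z) is the full polarization of the degree-d form p at the points z - b_j,
   that is, the result of applying to p the successive polar derivatives
   f |-> D f - (X - c) f' with poles c = z - b_j. By Laguerre's half-plane theorem p * q
   has no zero in the upper half-plane as soon as the roots of p and q have nonpositive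
   imaginary part. Letting one root of p vary in the lower half-plane shows that
   (p * q) / ((p / (X - a)) * q) maps the upper half-plane to itself, whence

   - if x is a multiple root of p * q, it is a root of (p / (X - a)) * q for every root a
     of p. Since polarizations are multi-affine and symmetric, the polarization of q at the
     points x - a, each taken once less than its multiplicity, vanishes identically; the
     equality case of Laguerre's inequality then forces some b = x - a to satisfy
     m_p(a) + m_q(b) > d;

   - the roots of p * q and of (p / (X - a)) * q interlace. Adding or removing one root of
     p at a time, starting from p = (X - a)^d, this controls the number of roots of p * q
     on each side of a + b up to one unit, and the sign of the first nonvanishing
     derivative at a + b settles the parity. *)

(** * Finite free convolution and its symmetric bilinear form *)

(** The convolution written as a constant-coefficient differential operator, read off from [q],
    applied to [p]. It is visibly linear in [p] and makes sense over [R] and [R[i]] alike. *)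
Definition ffconv (F : numFieldType) (d : nat) (p q : {poly F}) : {poly F} :=
  \sum_(k < d.+1) (q^`(d - k).[0] / d`!%:R) *: p^`(k).

Lemma natr_fact_neq0 (F : numFieldType) n : n`!%:R != 0 :> F.
Proof. by rewrite pnatr_eq0 -lt0n fact_gt0. Qed.

Lemma horner_derivn0 (F : numFieldType) (q : {poly F}) n :
  q^`(n).[0] = q`_n * n`!%:R.
Proof. by rewrite horner_coef0 coef_derivn addn0 ffactnn mulr_natr. Qed.

Lemma coef_ffconv (F : numFieldType) (d i : nat) (p q : {poly F}) :
  (size p <= d.+1)%N ->
  (ffconv d p q)`_i = \sum_(k < d.+1 | (k + i <= d)%N)
    p`_(k + i) * q`_(d - k) * ((k + i)`!%:R * (d - k)`!%:R / (i`!%:R * d`!%:R)).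
Proof.
move=> sp; rewrite /ffconv coef_sum (bigID (fun k : 'I_d.+1 => (k + i <= d)%N)) /=.
rewrite [X in _ + X]big1 ?addr0; last first.
  move=> k kid; rewrite coefZ coef_derivn nth_default ?mul0rn ?mulr0 //.
  by rewrite (leq_trans sp) // ltnNge.
apply: eq_bigr => k kid; rewrite coefZ coef_derivn horner_derivn0 -[p`_(_) *+ _]mulr_natr.
have e : ((k + i) ^_ k)%:R = (k + i)`!%:R / i`!%:R :> F.
  apply: (canRL (mulfK (natr_fact_neq0 F i))).
  by rewrite -natrM -(ffact_fact (leq_addr i k)) addKn.
rewrite e; field; by rewrite !natr_fact_neq0.
Qed.

Lemma sum_ord_addn_leq (V : nmodType) (d i : nat) (G : nat -> V) : (i <= d)%N ->
  \sum_(k < d.+1 | (k + i <= d)%N) G k = \sum_(k < (d - i).+1) G k.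
Proof.
move=> id; rewrite (big_ord_widen_cond d.+1 predT) /=; last by rewrite ltnS leq_subr.
by apply: eq_bigl => k; rewrite ltnS leq_subRL // addnC.
Qed.

Lemma ffconvC (F : numFieldType) (d : nat) (p q : {poly F}) :
  (size p <= d.+1)%N -> (size q <= d.+1)%N -> ffconv d p q = ffconv d q p.
Proof.
move=> sp sq; apply/polyP => i; rewrite !coef_ffconv //.
have [id | di] := leqP i d; last first.
  by rewrite !big_pred0 // => k; apply/negbTE; rewrite -ltnNge ltn_addl.
pose G a b (k : nat) := a`_(k + i) * b`_(d - k) *
  ((k + i)`!%:R * (d - k)`!%:R / (i`!%:R * d`!%:R)) : F.
rewrite !(sum_ord_addn_leq (G _ _) id) (reindex_inj rev_ord_inj) /=.
apply: eq_bigr => k _; rewrite /G subSS.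
have kd : (k <= d - i)%N by rewrite -ltnS.
have -> : (d - i - k + i = d - k)%N by lia.
have -> : (d - (d - i - k) = k + i)%N by lia.
by rewrite [(k + i)`!%:R * _]mulrC [p`_ _ * _]mulrC.
Qed.

Lemma boxplusE (R : rcfType) (d : nat) (p q : {poly R}) :
  (size p <= d.+1)%N -> boxplus d p q = ffconv d p q.
Proof.
move=> sp; apply/polyP => i; rewrite coef_ffconv // /boxplus coef_sum.
have [id | di] := leqP i d; last first.
  rewrite big1 => [|k _]; last by rewrite coefZ coefXn; case: eqP; rewrite ?mulr0 //; lia.
  by rewrite big_pred0 // => k; apply/negbTE; rewrite -ltnNge ltn_addl.
have did : (d - i < d.+1)%N by rewrite ltnS leq_subr.
rewrite (bigD1 (Ordinal did)) //= [X in _ + X]big1 ?addr0; last first.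
  move=> k /eqP ki; rewrite coefZ coefXn; case: eqP; rewrite ?mulr0 // => e.
  by case: ki; apply/val_inj; have := ltn_ord k => /=; lia.
rewrite coefZ coefXn subKn // eqxx mulr1 mulr_sumr.
pose G (k : nat) := p`_(k + i) * q`_(d - k) *
  ((k + i)`!%:R * (d - k)`!%:R / (i`!%:R * d`!%:R)) : R.
rewrite (sum_ord_addn_leq G id) (reindex_inj rev_ord_inj) /=.
apply: eq_bigr => k _; rewrite /G subSS.
have kd : (k <= d - i)%N by rewrite -ltnS.
rewrite /etilde; set j := (d - i - k)%N.
have B n m : (m <= n)%N -> 'C(n, m)%:R = n`!%:R / (m`!%:R * (n - m)`!%:R) :> R.
  move=> mn; apply: (canRL (mulfK _)); first by rewrite mulf_neq0 ?natr_fact_neq0.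
  by rewrite -!natrM bin_fact.
have jd : (j <= d)%N by rewrite /j; lia.
have kdd : (d - i - j <= d)%N by lia.
rewrite !B ?leq_subr //.
have -> : (d - i - j = k)%N by rewrite /j; lia.
have -> : (d - (d - i) = i)%N by lia.
have kd' : (k <= d)%N by lia.
(* The sign of [boxplus] splits into the signs of its two [etilde] factors, so each sign occurs
   squared and disappears. *)
have -> : (-1) ^+ (d - i) = (-1) ^+ j * (-1) ^+ k :> R.
  by rewrite -exprD; congr (_ ^+ _); rewrite /j; lia.
have -> : (d - j = k + i)%N by rewrite /j; lia.
have s2 n : (-1) ^+ n * (-1) ^+ n = 1 :> R by rewrite -exprMn mulrNN mulr1 expr1n.
move: (s2 j) (s2 k); move: ((-1) ^+ j) ((-1) ^+ k) => u v uu vv.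
transitivity (u * u * (v * v) * G k); last by rewrite uu vv !mul1r.
by rewrite /G; field; rewrite !natr_fact_neq0.
Qed.

(** * Polar derivatives, polarization and the apolar pairing *)

(* [f] is read as a form of degree [D], with a root at infinity when [size f <= D]. *)
Definition polar_deriv (F : numFieldType) (D : nat) (c : F) (f : {poly F}) : {poly F} :=
  f *+ D - ('X - c%:P) * f^`().

Fixpoint polarize (F : numFieldType) (D : nat) (s : seq F) (f : {poly F}) : {poly F} :=
  if s is c :: s' then polarize D.-1 s' (polar_deriv D c f) else f.

(** The classical apolarity pairing of two forms of degree [D], up to normalization. On polynomials
    of size at most [D.+1] it is a constant, so it can be evaluated at any convenient point. *)
Definition apolar (F : numFieldType) (D : nat) (f Q : {poly F}) : {poly F} :=
  \sum_(k < D.+1) (-1) ^+ k *: (f^`(k) * Q^`(D - k)).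

Lemma deriv_eq0 (F : numFieldType) (p : {poly F}) :
  p^`() = 0 -> p = (p.[0])%:P.
Proof.
move=> dp; apply/polyP => -[|i]; first by rewrite coefC eqxx horner_coef0.
have := congr1 (fun q : {poly F} => q`_i) dp.
rewrite coef_deriv coef0 coefC /= => /eqP.
by rewrite mulrn_eq0 => /orP[|/eqP].
Qed.

(** The derivative telescopes to its two end terms, which contain the derivatives of order [D.+1] of
    [f] and of [Q] and therefore vanish. *)
Lemma horner_apolar_indep (F : numFieldType) (D : nat) (f Q : {poly F}) (x y : F) :
  (size f <= D.+1)%N -> (size Q <= D.+1)%N -> (apolar D f Q).[x] = (apolar D f Q).[y].
Proof.
move=> sf sQ; suff /deriv_eq0 -> : (apolar D f Q)^`() = 0 by rewrite !hornerC.
rewrite /apolar raddf_sum /=.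
pose G k := - ((-1) ^+ k *: (f^`(k) * Q^`(D.+1 - k))).
rewrite (eq_bigr (fun k : 'I_D.+1 => G k.+1 - G k)); last first.
  move=> k _; rewrite derivZ derivM -!derivnS /G subSS subSn; last by rewrite -ltnS.
  by rewrite exprS mulN1r scaleNr !opprK -scalerDr.
rewrite -(big_mkord predT (fun k => G k.+1 - G k)) telescope_sumr //.
rewrite /G subn0 subnn (derivn_poly0 sf) (derivn_poly0 sQ).
by rewrite mul0r mulr0 !scaler0 subrr.
Qed.

Lemma derivn_XsubCM (F : numFieldType) (c : F) (h : {poly F}) (n : nat) :
  (('X - c%:P) * h)^`(n) = ('X - c%:P) * h^`(n) + h^`(n.-1) *+ n.
Proof.
elim: n => [|n IH]; first by rewrite mulr0n addr0.
rewrite derivnS IH derivD derivM derivXsubC mul1r derivMn -!derivnS /= mulrS.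
case: n {IH} => [|n]; rewrite ?mulr0n ?addr0 addrC // -addrA [h^`(_) *+ _ + _]addrC.
by rewrite addrA [_ + ('X - _) * _]addrC -addrA.
Qed.

Lemma size_polar_deriv (F : numFieldType) (D : nat) (c : F) (f : {poly F}) :
  (size f <= D.+2)%N -> (size (polar_deriv D.+1 c f) <= D.+1)%N.
Proof.
move=> sf; apply/leq_sizeP => i Di; rewrite /polar_deriv coefB coefMn mulrBl coefB.
rewrite coefXM coefCM !coef_deriv.
case: i Di => // i Di; rewrite /=.
have -> : f`_i.+2 = 0 by rewrite nth_default // (leq_trans sf).
rewrite mul0rn mulr0 subr0.
move: Di; rewrite ltnS leq_eqVlt => /predU1P[->|Di]; first by rewrite subrr.
by rewrite nth_default ?mul0rn ?subrr // (leq_trans sf).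
Qed.

Lemma horner_derivn_polar_deriv (F : numFieldType) (D k : nat) (c : F) (f : {poly F}) :
  ((polar_deriv D c f)^`(k)).[c] = f^`(k).[c] * (D%:R - k%:R).
Proof.
rewrite /polar_deriv derivnB derivnMn derivn_XsubCM !hornerE subrr mul0r add0r.
rewrite !hornerMn; case: k => [|k] /=; first by rewrite mulr0n subr0 oppr0 addr0 mulr_natr.
by rewrite -derivSn mulrBr !mulr_natr.
Qed.

(** Induction on the poles. Both pairings are constant, so they can be compared at the pole [c]
    itself: there the polar derivative multiplies the [k]-th derivative of [f] by [D - k], and the
    factor ['X - c%:P] of the product contributes the same number by Leibniz' rule. *)
Lemma polarize_apolar (F : numFieldType) (D : nat) (s : seq F) (f : {poly F}) (y : F) :
  (size f <= D.+1)%N -> size s = D ->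
  (polarize D s f).[y] = (apolar D f (\prod_(c <- s) ('X - c%:P))).[y].
Proof.
elim: s D f => [|c s IH] [|D] f sf //= ss.
  by rewrite big_nil /apolar big_ord1 scale1r /= mulr1.
case: ss => ss; set Q := \prod_(c <- s) ('X - c%:P) in IH *.
have sQ : size Q = D.+1 by rewrite size_prod_XsubC ss.
rewrite IH ?size_polar_deriv // (@horner_apolar_indep _ _ _ _ y c) ?size_polar_deriv ?sQ //.
rewrite (@horner_apolar_indep _ D.+1 _ _ y c) ?size_prod_XsubC /= ?ss //.
rewrite big_cons -/Q /apolar [in RHS]big_ord_recr /= subnn !hornerD !horner_sum.
rewrite [X in _ = _ + X](_ : _ = 0) ?addr0; last first.
  by rewrite hornerZ !hornerM hornerXsubC subrr mul0r !mulr0.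
apply: eq_bigr => k _; rewrite !hornerE horner_derivn_polar_deriv derivn_XsubCM !hornerE.
have kD : (k <= D)%N by rewrite -ltnS.
rewrite subrr mul0r add0r hornerMn subSn //= -natrB ?(leq_trans kD) // subSn //.
by rewrite -[in RHS]mulr_natr; ring.
Qed.

Lemma derivn_comp_subX (F : numFieldType) (z : F) (q : {poly F}) (n : nat) :
  (q \Po (z%:P - 'X))^`(n) = (-1) ^+ n *: (q^`(n) \Po (z%:P - 'X)).
Proof.
elim: n => [|n IH]; first by rewrite scale1r.
rewrite derivnS IH derivZ deriv_comp -derivnS derivB derivC derivX sub0r.
by rewrite mulrN1 scalerN exprS mulN1r scaleNr.
Qed.

Lemma size_subX (F : numFieldType) (z : F) : size (z%:P - 'X : {poly F}) = 2.
Proof. by rewrite -opprB size_polyN size_XsubC. Qed.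

Lemma horner_apolar_comp (F : numFieldType) (d : nat) (p q : {poly F}) (z y : F) :
  (apolar d p (q \Po (z%:P - 'X))).[y] =
  (-1) ^+ d * \sum_(k < d.+1) p^`(k).[y] * q^`(d - k).[z - y].
Proof.
rewrite /apolar horner_sum mulr_sumr; apply: eq_bigr => k _.
rewrite derivn_comp_subX hornerZ hornerM hornerZ horner_comp hornerD hornerN hornerC hornerX.
have -> : (-1) ^+ d = (-1) ^+ k * (-1) ^+ (d - k) :> F.
  by rewrite -exprD subnKC // -ltnS.
by ring.
Qed.

Lemma horner_ffconv (F : numFieldType) (d : nat) (p q : {poly F}) (z : F) :
  d`!%:R * (ffconv d p q).[z] = \sum_(k < d.+1) p^`(k).[z] * q^`(d - k).[0].
Proof.
rewrite /ffconv horner_sum mulr_sumr; apply: eq_bigr => k _.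
by rewrite hornerZ; field; rewrite natr_fact_neq0.
Qed.

(** Up to sign the sum is the apolar pairing of [p] with [q] composed with [z - X]. Moving the
    evaluation point from [z] to [z - b] recentres the convolution at any [b]. *)
Lemma horner_ffconv_shift (F : numFieldType) (d : nat) (p q : {poly F}) (z b : F) :
  (size p <= d.+1)%N -> (size q <= d.+1)%N ->
  d`!%:R * (ffconv d p q).[z] = \sum_(k < d.+1) p^`(k).[z - b] * q^`(d - k).[b].
Proof.
move=> sp sq; have s0 : (-1) ^+ d != 0 :> F by rewrite signr_eq0.
apply: (mulfI s0); rewrite horner_ffconv.
have := @horner_apolar_indep _ d p (q \Po (z%:P - 'X)) z (z - b) sp.
rewrite size_comp_poly2 ?size_subX // => /(_ sq).
by rewrite !horner_apolar_comp subrr subKr.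
Qed.

Lemma polarize_ffconv (F : numFieldType) (d : nat) (p : {poly F}) (s : seq F) (z y : F) :
  (size p <= d.+1)%N -> size s = d ->
  (polarize d [seq z - b | b <- s] p).[y] =
  d`!%:R * (ffconv d p (\prod_(b <- s) ('X - b%:P))).[z].
Proof.
move=> sp ss; rewrite (polarize_apolar y sp) ?size_map //.
set q := \prod_(b <- s) _.
have sq : size q = d.+1 by rewrite size_prod_XsubC ss.
rewrite (_ : \prod_(c <- _) _ = (-1) ^+ d *: (q \Po (z%:P - 'X))); last first.
  rewrite big_map -ss rmorph_prod /=.
  elim: (s) => [|b t IH]; first by rewrite !big_nil scale1r.
  rewrite !big_cons IH /= exprS mulN1r scaleNr -scalerAr -scalerN -mulNr.
  congr (_ *: (_ * _)); rewrite comp_polyB comp_polyX comp_polyC polyCB.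
  by ring.
have -> : apolar d p ((-1) ^+ d *: (q \Po (z%:P - 'X))) =
          (-1) ^+ d *: apolar d p (q \Po (z%:P - 'X)).
  rewrite /apolar scaler_sumr; apply: eq_bigr => k _.
  by rewrite derivnZ -scalerAr !scalerA mulrC.
rewrite hornerZ (@horner_apolar_indep _ d p _ y z sp); last first.
  by rewrite size_comp_poly2 ?size_subX // sq.
rewrite horner_apolar_comp subrr mulrA -exprD addnn -mul2n exprM sqrrN !expr1n mul1r.
by rewrite horner_ffconv.
Qed.

Lemma ffconvDl (F : numFieldType) (d : nat) (q : {poly F}) (a : F) (p1 p2 : {poly F}) :
  ffconv d (a *: p1 + p2) q = a *: ffconv d p1 q + ffconv d p2 q.
Proof.
rewrite /ffconv scaler_sumr -big_split /=; apply: eq_bigr => k _.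
by rewrite derivnD derivnZ scalerDr !scalerA mulrC.
Qed.

Lemma map_ffconv (F G : numFieldType) (f : {rmorphism F -> G}) (d : nat) (p q : {poly F}) :
  map_poly f (ffconv d p q) = ffconv d (map_poly f p) (map_poly f q).
Proof.
rewrite /ffconv rmorph_sum; apply: eq_bigr => k _ /=.
by rewrite map_polyZ rmorphM fmorphV rmorph_nat !derivn_map -horner_map /= rmorph0.
Qed.

Lemma ffconv_monic (F : numFieldType) (d : nat) (p q : {poly F}) :
  p \is monic -> (size p <= d.+1)%N -> q \is monic -> size q = d.+1 ->
  ffconv d p q \is monic /\ size (ffconv d p q) = size p.
Proof.
move=> mp sp mq sq; have p0 : (0 < size p)%N by rewrite size_poly_gt0 monic_neq0.
rewrite /ffconv big_ord_recl subn0 horner_derivn0.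
move: mq; rewrite monicE lead_coefE sq /= => /eqP ->.
rewrite mul1r divff ?natr_fact_neq0 // scale1r.
set r := \sum_(k < d) _; have sr : (size r < size p)%N.
  rewrite -(prednK p0) ltnS; apply: (leq_trans (size_sum _ _ _)).
  apply/bigmax_leqP => k _; apply: (leq_trans (size_scale_leq _ _)).
  rewrite add0n -derivnS; apply/leq_sizeP => j pj; rewrite coef_derivn nth_default ?mul0rn //=.
  by rewrite -(prednK p0) addSn ltnS (leq_trans pj) ?leq_addl.
by rewrite monicE lead_coefDl // size_polyDl //.
Qed.

(** * Stability in the upper half-plane *)

Definition upper_stable (C : numClosedFieldType) (f : {poly C}) : Prop :=
  forall z, 0 < 'Im z -> f.[z] != 0.

Lemma horner_deriv_prod (F : fieldType) (s : seq F) (z : F) : z \notin s ->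
  (\prod_(x <- s) ('X - x%:P))^`().[z] =
  (\prod_(x <- s) ('X - x%:P)).[z] * \sum_(x <- s) (z - x)^-1.
Proof.
elim: s => [|a s IH]; first by rewrite !big_nil derivC horner0 mulr0.
rewrite inE negb_or => /andP[za /IH {}IH].
rewrite !big_cons derivM derivXsubC mul1r hornerD !hornerM IH hornerXsubC.
rewrite mulrDr; have za0 : z - a != 0 by rewrite subr_eq0.
by rewrite [(z - a) * _ * (z - a)^-1]mulrAC divff // mul1r mulrA.
Qed.

(** The equality case of Laguerre's inequality, by a variance argument. With [W] the inverse of
    [z - c], comparing imaginary parts bounds the sum of the squared moduli of the inverses of
    [z - x] by [D] times that of [W]. The squared distances of these inverses to [W] then sum to at
    most [size l - D] times the squared modulus of [W], which is nonpositive, so all of them are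
    zero. *)
Lemma sum_inv_halfplane (C : numClosedFieldType) (D : nat) (l : seq C) (z c : C) :
  {in l, forall x, 'Im x <= 0} -> (size l <= D)%N -> 0 <= 'Im c -> 0 < 'Im z ->
  z != c -> \sum_(x <- l) (z - x)^-1 = D%:R / (z - c) -> l = nseq D c.
Proof.
move=> hl sl hc hz zc e; set W := (z - c)^-1 in e.
have ImV (x : C) : - 'Im (x^-1) = 'Im x * `|x^-1| ^+ 2.
  have [->|x0] := eqVneq x 0; first by rewrite invr0 raddf0 mul0r oppr0.
  rewrite normfV invC_norm -[X in 'Im X]mulrC ImMr ?Im_conj ?mulNr ?opprK ?exprVn //.
  by rewrite rpredV rpredX ?normr_real.
have W0 : 0 < `|W| ^+ 2 by rewrite exprn_gt0 // normr_gt0 invr_eq0 subr_eq0.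
have hW : - 'Im W <= 'Im z * `|W| ^+ 2.
  by rewrite ImV ler_wpM2r ?(ltW W0) // raddfB /= lerBlDr lerDl.
have hS : \sum_(x <- l) `|(z - x)^-1| ^+ 2 <= D%:R * `|W| ^+ 2.
  rewrite -(ler_pM2l hz) mulrCA.
  apply: (@le_trans _ _ (D%:R * (- 'Im W))); last by rewrite ler_wpM2l ?ler0n.
  rewrite mulrN -ImMl ?realn // -e raddf_sum /= -sumrN mulr_sumr.
  rewrite big_seq [leRHS]big_seq; apply: ler_sum => x xl.
  by rewrite ImV ler_wpM2r ?exprn_ge0 ?normr_ge0 // raddfB /= lerDl oppr_ge0 hl.
have key : \sum_(x <- l) `|(z - x)^-1 - W| ^+ 2 <= ((size l)%:R - D%:R) * `|W| ^+ 2.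
  under eq_bigr => x _ do rewrite normCK rmorphB mulrBl !mulrBr -!normCK opprB.
  rewrite !big_split /= !sumrN big_const_seq count_predT iter_addr_0.
  rewrite -mulr_suml -mulr_sumr -rmorph_sum e /= rmorphM rmorph_nat -mulrA.
  rewrite [W * (_ * _)]mulrCA -normCK -[_ *+ size l]mulr_natl mulrBl.
  by rewrite -subr_le0 addrK subr_le0.
have n0 : (0 <= \sum_(x <- l) `|(z - x)^-1 - W| ^+ 2).
  by apply: sumr_ge0 => x _; rewrite exprn_ge0.
have /eqP slD : size l == D.
  rewrite eqn_leq sl /= -(ler_nat C) -subr_ge0 -(pmulr_lge0 _ W0).
  exact: le_trans n0 key.
have {}key : \sum_(x <- l) `|(z - x)^-1 - W| ^+ 2 = 0.
  by apply/le_anti; rewrite n0 andbT (le_trans key) // slD subrr mul0r.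
move/eqP: key; rewrite psumr_eq0; last by move=> x _; rewrite exprn_ge0.
move=> /allP h; rewrite -slD; apply/all_pred1P/allP => x xl /=.
move: (h x xl); rewrite /= expf_eq0 /= normr_eq0 subr_eq0 => /eqP /invr_inj /eqP.
by rewrite (inj_eq (addrI z)) eqr_opp.
Qed.

(** Laguerre's theorem with its equality case: a zero of the polar derivative at [z] says that the
    logarithmic derivative of [f] at [z] equals that of the [D]-th power of ['X - c%:P]. The case
    [z = c] is separate and leaves only [D = 0]. *)
Lemma polar_deriv_halfplane (C : numClosedFieldType) (D : nat) (c z : C) (f : {poly C}) :
  upper_stable f -> (size f <= D.+1)%N -> 0 <= 'Im c -> 0 < 'Im z ->
  (polar_deriv D c f).[z] = 0 -> exists k, f = k *: ('X - c%:P) ^+ D.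
Proof.
move=> hf sf hc hz; have fz := hf z hz.
have f0 : f != 0 by apply: contraNneq fz => ->; rewrite horner0.
rewrite /polar_deriv hornerD hornerN hornerM hornerMn hornerXsubC => /eqP.
rewrite subr_eq0 => /eqP; have [zc|zc] := eqVneq z c.
  rewrite zc subrr mul0r => /eqP; rewrite mulrn_eq0 => /orP[/eqP D0|/eqP fc].
    by exists f.[0]; move: sf; rewrite D0 alg_polyC => /size1_polyC ->; rewrite hornerC.
  by rewrite zc fc eqxx in fz.
have [l fl] := closed_field_poly_normal f; set k := lead_coef f in fl.
have k0 : k != 0 by rewrite lead_coef_eq0.
have zl : z \notin l.
  apply: contraNN fz; rewrite -root_prod_XsubC fl hornerZ => /rootP ->.
  by rewrite mulr0.
rewrite fl derivZ !hornerZ (horner_deriv_prod zl) => e.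
exists k; congr (_ *: _).
have -> : l = nseq D c; last by rewrite big_nseq iter_mulr_1.
apply: (sum_inv_halfplane (z := z)) => //.
- move=> x xl; rewrite real_leNgt ?Creal_Im //; apply/negP => /hf.
  move: xl; rewrite -root_prod_XsubC fl hornerZ => /rootP ->.
  by rewrite mulr0 eqxx.
- by rewrite -ltnS (leq_trans _ sf) // fl size_scale // size_prod_XsubC.
move: e fz; rewrite fl hornerZ; set P := _.[z]; set S := \sum_(x <- l) _.
move=> e P0; have zc0 : z - c != 0 by rewrite subr_eq0.
apply: (mulIf zc0); rewrite mulfVK //; apply: (mulfI P0).
by rewrite mulr_natr e; ring.
Qed.

Lemma upper_stable_polar_deriv (C : numClosedFieldType) (D : nat) (c : C) (f : {poly C}) :
  upper_stable f -> (size f <= D.+2)%N -> 0 < 'Im c -> upper_stable (polar_deriv D.+1 c f).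
Proof.
move=> hf sf hc z hz; apply/eqP => /(polar_deriv_halfplane hf sf (ltW hc) hz) [k e].
by have := hf c hc; rewrite e hornerZ horner_exp hornerXsubC subrr expr0n mulr0 eqxx.
Qed.

Lemma upper_stable_polarize (C : numClosedFieldType) (s : seq C) (f : {poly C}) :
  upper_stable f -> (size f <= (size s).+1)%N -> {in s, forall c, 0 < 'Im c} ->
  upper_stable (polarize (size s) s f).
Proof.
elim: s f => //= c s IH f hf sf hs; apply: IH.
- by apply: upper_stable_polar_deriv => //; apply: hs; rewrite mem_head.
- exact: size_polar_deriv.
- by move=> x xs; apply: hs; rewrite inE xs orbT.
Qed.

Lemma upper_stable_ffconv (C : numClosedFieldType) (p : {poly C}) (s : seq C) :
  upper_stable p -> (size p <= (size s).+1)%N -> {in s, forall b, 'Im b <= 0} ->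
  upper_stable (ffconv (size s) p (\prod_(b <- s) ('X - b%:P))).
Proof.
move=> hp sp hs z hz.
have := @upper_stable_polarize _ [seq z - b | b <- s] p hp.
rewrite size_map => /(_ sp) h; have /h/(_ z hz) : {in [seq z - b | b <- s], forall c, 0 < 'Im c}.
  move=> _ /mapP[b bs ->]; rewrite raddfB /= subr_gt0.
  exact: le_lt_trans (hs b bs) hz.
by rewrite polarize_ffconv // mulf_eq0 negb_or => /andP[].
Qed.

(** * Boundary zeros of self-maps of the upper half-plane *)

Lemma leC_Im (C : numClosedFieldType) (x : C) : 'Im x <= `|x|.
Proof.
apply: (le_trans (real_ler_norm (Creal_Im x))).
rewrite -(ler_pXn2r (n := 2)) ?nnegrE // real_normK ?Creal_Im // normC2_Re_Im.
by rewrite lerDr real_exprn_even_ge0 // Creal_Re.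
Qed.

Lemma Im_horner_at0_ge0 (C : numClosedFieldType) (G : {poly C}) :
  (forall e, 0 < e -> 0 <= 'Im G.[e]) -> 0 <= 'Im G.[0].
Proof.
move=> hG; rewrite real_leNgt ?Creal_Im ?real0 //; apply/negP => neg.
have /factor_theorem[G1 eG] : root (G - (G.[0])%:P) 0 by rewrite rootE !hornerE subrr.
have [K hK] := poly_disk_bound G1 1.
have K0 : 0 <= K by apply: le_trans (hK 0 _); rewrite ?normr0.
set d := - 'Im G.[0]; have d0 : 0 < d by rewrite oppr_gt0.
(* An explicit continuity argument: [e] is at most 1, so the bound [K] on the unit disk applies, and
   [e * K < d], too small a change to make the imaginary part nonnegative. *)
pose e := d / (d + K + 1); have q0 : 0 < d + K + 1 by rewrite ltr_wpDl // addr_ge0 // ltW.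
have e0 : 0 < e by rewrite divr_gt0.
have e1 : e <= 1 by rewrite ler_pdivrMr // mul1r -addrA lerDl addr_ge0.
have := hG e e0; apply/negP; rewrite -real_ltNge ?Creal_Im ?real0 //.
have -> : G = G1 * 'X + (G.[0])%:P by rewrite -[X in G1 * X]subr0 -eG subrK.
rewrite hornerD hornerM hornerX hornerC raddfD /= -ltrBrDr sub0r -/d.
apply: le_lt_trans (_ : e * K < d); last first.
  rewrite /e mulrAC ltr_pdivrMr // ltr_pM2l // addrAC -[ltLHS]add0r ltrD2r.
  by rewrite addr_gt0.
apply: (le_trans (leC_Im _)); rewrite normrM [_ * `|e|]mulrC (gtr0_norm e0) ler_pM2l //.
by apply: hK; rewrite gtr0_norm.
Qed.

(* Near [rho] the product looks like [k u^M] with [k] real, and for [M >= 2] the imaginary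
   part of [u^M] takes both signs on the upper half-plane. *)
Lemma herglotz_order (C : numClosedFieldType) (M : nat) (rho : C) (h w : {poly C}) :
  rho \is Num.real -> h.[rho] * (w.[rho])^* \is Num.real -> h.[rho] * (w.[rho])^* != 0 ->
  (forall z, 0 < 'Im z -> 0 < 'Im ((('X - rho%:P) ^+ M * h).[z] * (w.[z])^*)) ->
  (M <= 1)%N /\ (M = 1%N -> 0 < h.[rho] * (w.[rho])^*).
Proof.
set k := h.[rho] * _ => hr kr k0 H.
have lim u : 0 < 'Im u -> 0 <= k * 'Im (u ^+ M).
  move=> hu; rewrite -ImMl //.
  (* Conjugating both the coefficients of [w] and the direction [u] turns the conjugate factor into
     a polynomial in the real parameter [e], so the limit [e = 0] can be taken. *)
  pose G := (u ^+ M) *: ((h \Po (rho%:P + u *: 'X)) *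
              (map_poly Num.conj_op w \Po (rho%:P + u^* *: 'X))).
  have eG e : e \is Num.real ->
      G.[e] = u ^+ M * (h.[rho + e * u] * (w.[rho + e * u])^*).
    move=> er; rewrite hornerZ hornerM !horner_comp !hornerD !hornerZ hornerX !hornerC.
    have ce : (rho + e * u)^* = rho + e * u^*.
      by rewrite rmorphD rmorphM /= (CrealP hr) (CrealP er).
    by rewrite -horner_map /= ce ![e * _]mulrC.
  have -> : k * u ^+ M = G.[0] by rewrite eG ?real0 // mul0r addr0 mulrC.
  apply: Im_horner_at0_ge0 => e e0; rewrite eG ?gtr0_real //.
  have hz : 0 < 'Im (rho + e * u).
    by rewrite raddfD /= (Creal_ImP _ hr) add0r ImMl ?gtr0_real // mulr_gt0.
  have := H _ hz; rewrite hornerM horner_exp hornerXsubC addrAC subrr add0r exprMn.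
  rewrite -mulrA -mulrA (ImMl (rpredX M (gtr0_real e0))) /= pmulr_rgt0 ?exprn_gt0 //.
  exact: ltW.
split; last first.
  move=> M1; rewrite lt_def k0; have := lim 'i; rewrite Im_i M1 expr1 Im_i mulr1.
  by apply; apply: ltr01.
rewrite leqNgt; apply/negP => M2.
have M0 : (0 < M)%N by apply: ltn_trans M2.
(* Every non-real [v] is the [M]-th power of a point of the open upper half-plane, as [M >= 2].
   Taking [v] to be ['i] and then [- 'i] forces [k = 0]. *)
have hv (v : C) : 'Im v != 0 -> 0 <= k * 'Im v.
  move=> v0; have := lim (M.-root v); rewrite rootCK //; apply.
  rewrite lt_def Im_rootC_ge0 // andbT; apply: contraNneq v0 => /Creal_ImP /(rpredX M).
  by rewrite rootCK // => /Creal_ImP ->.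
have := hv 'i; rewrite Im_i oner_eq0 mulr1 => /(_ isT) kp.
have := hv (- 'i); rewrite raddfN /= Im_i oppr_eq0 oner_eq0 mulrN mulr1 oppr_ge0.
by move=> /(_ isT) kn; move: k0; rewrite eq_le kp kn.
Qed.

(** * Real polynomials over the complex numbers *)

Definition cpoly (R : rcfType) (p : {poly R}) : {poly R[i]} := map_poly (real_complex R) p.

Definition split_poly (R : rcfType) (s : seq R) : {poly R} := \prod_(x <- s) ('X - x%:P).

Lemma cpoly_split (R : rcfType) (s : seq R) :
  cpoly (split_poly s) = \prod_(x <- [seq real_complex R x | x <- s]) ('X - x%:P).
Proof.
by rewrite /cpoly rmorph_prod big_map; apply: eq_bigr => x _; rewrite /= map_polyXsubC.
Qed.

Lemma real_complex_real (R : rcfType) (x : R) : real_complex R x \is Num.real.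
Proof. by apply/complex_realP; exists x. Qed.

Lemma Im_real_complex (R : rcfType) (x : R) : 'Im (real_complex R x) = 0.
Proof. exact/Creal_ImP/real_complex_real. Qed.

Lemma conj_horner_cpoly (R : rcfType) (p : {poly R}) (z : R[i]) :
  ((cpoly p).[z])^* = (cpoly p).[z^*].
Proof.
rewrite -horner_map /=; congr (_.[_]); apply/polyP => i.
by rewrite coef_map coef_map /=; apply/CrealP/real_complex_real.
Qed.

Lemma horner_cpoly (R : rcfType) (p : {poly R}) (x : R) :
  (cpoly p).[real_complex R x] = real_complex R p.[x].
Proof. by rewrite /cpoly horner_map. Qed.

Lemma upper_stable_prod (C : numClosedFieldType) (s : seq C) :
  {in s, forall x, 'Im x <= 0} -> upper_stable (\prod_(x <- s) ('X - x%:P)).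
Proof.
move=> hs z hz; apply/negP => /eqP/rootP; rewrite root_prod_XsubC => /hs.
by move=> /(lt_le_trans hz); rewrite ltxx.
Qed.

Lemma upper_stable_split (R : rcfType) (s : seq R) : upper_stable (cpoly (split_poly s)).
Proof.
by rewrite cpoly_split; apply: upper_stable_prod => _ /mapP[x _ ->]; rewrite Im_real_complex.
Qed.

(** Non-real roots of a real polynomial come in conjugate pairs, one of them in the upper
    half-plane. *)
Lemma split_upper_stable (R : rcfType) (f : {poly R}) :
  upper_stable (cpoly f) -> exists s, f = lead_coef f *: split_poly s.
Proof.
move=> hf; have f0 : f != 0.
  have := hf 'i; rewrite Im_i ltr01 => /(_ isT).
  by apply: contraNneq => ->; rewrite /cpoly rmorph0 horner0.
have [l fl] := closed_field_poly_normal (cpoly f).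
have rf z : z \in l -> root (cpoly f) z.
  by move=> zl; rewrite fl rootZ ?root_prod_XsubC // lead_coef_eq0 map_poly_eq0.
have lr : {in l, forall z, z \is Num.real}.
  move=> z /rf rz; apply/Creal_ImP.
  have [hz|hz|//] := real_ltgt0P (Creal_Im z); first by move: (hf z hz); rewrite -rootE rz.
  have /hf : 0 < 'Im (z^*) by rewrite Im_conj oppr_gt0.
  by rewrite -conj_horner_cpoly conjC_eq0 -rootE rz.
exists [seq complex.Re z | z <- l].
have inj : injective (map_poly (real_complex R)) by apply: map_poly_inj.
apply: inj; rewrite -/(cpoly f) fl map_polyZ lead_coef_map -/(cpoly _) cpoly_split.
rewrite -map_comp; congr (_ *: _); rewrite big_map big_seq [RHS]big_seq.
by apply: eq_bigr => z zl /=; rewrite RRe_real // lr.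
Qed.

Lemma cpoly_ffconv (R : rcfType) (d : nat) (p q : {poly R}) :
  cpoly (ffconv d p q) = ffconv d (cpoly p) (cpoly q).
Proof. exact: map_ffconv. Qed.

(* [r / w] maps the open upper half-plane to itself. *)
Definition herglotz (R : rcfType) (r w : {poly R}) : Prop :=
  forall z : R[i], 0 < 'Im z -> 0 < 'Im ((cpoly r).[z] * ((cpoly w).[z])^*).

Lemma herglotz_at_root (R : rcfType) (M : nat) (rho : R) (h w : {poly R}) :
  herglotz (('X - rho%:P) ^+ M * h) w -> h.[rho] * w.[rho] != 0 ->
  (M <= 1)%N /\ (M = 1%N -> 0 < h.[rho] * w.[rho]).
Proof.
move=> H hw.
have e : (cpoly h).[real_complex R rho] * ((cpoly w).[real_complex R rho])^* =
    real_complex R (h.[rho] * w.[rho]).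
  by rewrite !horner_cpoly rmorphM /=; congr (_ * _); apply/CrealP/real_complex_real.
have := @herglotz_order _ M (real_complex R rho) (cpoly h) (cpoly w).
rewrite e fmorph_eq0 => /(_ (real_complex_real _) (real_complex_real _) hw).
rewrite (ltcR 0); apply => z hz.
by have := H z hz; rewrite /cpoly rmorphM rmorphXn /= map_polyXsubC.
Qed.

Lemma upper_stable_ffconv_real (R : rcfType) (d : nat) (p : {poly R[i]}) (t : seq R) :
  upper_stable p -> (size p <= d.+1)%N -> size t = d ->
  upper_stable (ffconv d p (cpoly (split_poly t))).
Proof.
move=> hp sp st; rewrite cpoly_split.
have e : size [seq real_complex R x | x <- t] = d by rewrite size_map.
rewrite -e in sp *; apply: upper_stable_ffconv => // _ /mapP[x _ ->].
by rewrite Im_real_complex.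
Qed.

(** If [sg], the value of [- r / w] at [z], had nonnegative imaginary part, replacing the root [a]
    by [a - sg] would keep all roots in the closed lower half-plane. By linearity the new
    convolution is [r + sg * w], which vanishes at [z], against stability. *)
Lemma ffconv_herglotz (R : rcfType) (d : nat) (a : R) (s t : seq R) :
  (size s < d)%N -> size t = d ->
  herglotz (ffconv d (split_poly (a :: s)) (split_poly t))
           (ffconv d (split_poly s) (split_poly t)).
Proof.
move=> sd st z hz; rewrite !cpoly_ffconv; set P := cpoly (split_poly s).
set Q := cpoly (split_poly t); set r := ffconv d _ Q; set w := ffconv d _ Q.
have sP : size P = (size s).+1 by rewrite size_map_poly size_prod_XsubC.
have w0 : w.[z] != 0.
  by apply: upper_stable_ffconv_real => //; [exact: upper_stable_split|rewrite sP ltnW].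
suff : 'Im (- (r.[z] / w.[z])) < 0.
  rewrite raddfN /= oppr_lt0 => h.
  have -> : r.[z] * (w.[z])^* = r.[z] / w.[z] * `|w.[z]| ^+ 2 by rewrite normCK mulrA divfK.
  by rewrite ImMr ?rpredX ?normr_real //= mulr_gt0 ?exprn_gt0 ?normr_gt0.
rewrite real_ltNge ?Creal_Im ?real0 //; apply/negP => h.
set sg := - _ in h.
have := @upper_stable_ffconv_real R d (sg *: P + cpoly (split_poly (a :: s))) t _ _ st z hz.
rewrite -/Q ffconvDl -/r -/w hornerD hornerZ /sg mulNr divfK // addNr eqxx.
have e : sg *: P + cpoly (split_poly (a :: s)) =
    \prod_(x <- (real_complex R a - sg) :: [seq real_complex R x | x <- s]) ('X - x%:P).
  rewrite /P !cpoly_split /= !big_cons -mul_polyC -mulrDl polyCB.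
  by congr (_ * _); ring.
move=> F; apply/notF/F; rewrite e.
  apply: upper_stable_prod => x; rewrite inE => /predU1P[->|/mapP[y _ ->]].
    by rewrite raddfB /= Im_real_complex sub0r oppr_le0.
  by rewrite Im_real_complex.
by rewrite size_prod_XsubC /= size_map ltnS.
Qed.

(** * Multiple roots of the convolution *)

Lemma polar_deriv_polyC (F : numFieldType) (D : nat) (c : F) (f : {poly F}) :
  polar_deriv D c f = D%:R%:P * f - ('X - c%:P) * f^`().
Proof. by rewrite /polar_deriv mul_polyC scaler_nat. Qed.

Lemma polar_deriv_comm (F : numFieldType) (D : nat) (a b : F) (f : {poly F}) :
  polar_deriv D a (polar_deriv D.+1 b f) = polar_deriv D b (polar_deriv D.+1 a f).
Proof.
rewrite !polar_deriv_polyC -natr1 polyCD !(derivB, derivM, derivD, derivC, derivX).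
by rewrite polyC1; ring.
Qed.

Lemma polar_derivE (F : numFieldType) (D : nat) (t : F) (f : {poly F}) :
  polar_deriv D t f = (f *+ D - 'X * f^`()) + t *: f^`().
Proof. by rewrite /polar_deriv -mul_polyC; ring. Qed.

Lemma polarize_lin (F : numFieldType) (D : nat) (s : seq F) (a : F) (f g : {poly F}) :
  polarize D s (f + a *: g) = polarize D s f + a *: polarize D s g.
Proof.
elim: s D f g => //= c s IH D f g; rewrite -IH; congr polarize.
by rewrite !polar_deriv_polyC derivD derivZ -!mul_polyC; ring.
Qed.

Lemma polarize_rem (F : numFieldType) (D : nat) (c : F) (s : seq F) (f : {poly F}) :
  c \in s -> (size s <= D)%N -> polarize D s f = polarize D (c :: rem c s) f.
Proof.
elim: s D f => //= a s IH D f; rewrite inE eq_sym.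
have [->//|ac] /= := eqVneq a c => cs sD.
case: D sD => [//|[|D]] sD; first by case: s cs sD {IH}.
by rewrite (IH D.+1) //= polar_deriv_comm.
Qed.

Lemma polarize_perm (F : numFieldType) (D : nat) (s t : seq F) (f : {poly F}) :
  perm_eq s t -> (size s <= D)%N -> polarize D s f = polarize D t f.
Proof.
elim: s t D f => [|c s IH] t D f st sD; first by move: st; rewrite perm_sym => /perm_nilP ->.
have ct : c \in t by rewrite -(perm_mem st) mem_head.
rewrite (polarize_rem f ct) -?(perm_size st) //=; apply: IH.
  by rewrite -(perm_cons c) (perm_trans st) // perm_to_rem.
by case: D sD.
Qed.

Lemma polarize_cat (F : numFieldType) (D : nat) (s t : seq F) (f : {poly F}) :
  polarize D (s ++ t) f = polarize (D - size s) t (polarize D s f).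
Proof. by elim: s D f => [|c s IH] D f /=; rewrite ?subn0 // IH -subn1 -subnDA. Qed.

Lemma polarize_affine0 (F : numFieldType) (D : nat) (a b t : F) (s : seq F) (f : {poly F}) :
  a != b -> polarize D (a :: s) f = 0 -> polarize D (b :: s) f = 0 -> polarize D (t :: s) f = 0.
Proof.
move=> ab; rewrite /= !polar_derivE !polarize_lin.
set A := polarize _ _ _; set B := polarize _ _ _.
move=> ha hb; have B0 : B = 0.
  apply/eqP; have /eqP : (a - b) *: B = 0.
    by rewrite scalerBl -(subrr 0) -{1}ha -hb opprD addrACA subrr add0r.
  by rewrite scaler_eq0 subr_eq0 (negPf ab).
by move: ha; rewrite B0 !scaler0.
Qed.

Lemma polar_deriv_all0 (F : numFieldType) (D : nat) (f : {poly F}) :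
  (forall t, polar_deriv D.+1 t f = 0) -> f = 0.
Proof.
move=> h; have df : f^`() = 0.
  have := h 1; have := h 0; rewrite !polar_derivE scale0r addr0 => ->.
  by rewrite add0r scale1r.
have /eqP := h 0; rewrite /polar_deriv df mulr0 subr0 -scaler_nat scaler_eq0 pnatr_eq0 /=.
by move/eqP.
Qed.

(* As a multi-affine symmetric function of its poles, the polarization of [f] vanishes once
   it does at all points obtained by moving one coordinate of a fixed tuple of distinct
   poles: freeze one pole and induct. *)
Lemma polarize_interpolation (F : numFieldType) (s : seq F) (f : {poly F}) :
  s != [::] -> uniq s ->
  (forall c u, c \in s -> polarize (size s) (u :: rem c s) f = 0) -> f = 0.
Proof.
elim: s f => // a s IH f _ us h; apply: (@polar_deriv_all0 _ (size s)) => t.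
case: s IH us h => [|b s] IH us h.
  by have := h a t (mem_head _ _); rewrite /= eqxx.
move: us; rewrite cons_uniq => /andP[as_ us].
apply: IH => // c u cs; have ac : a != c by apply: contraNneq as_ => ->.
have sc : size (rem c (b :: s)) = size s by rewrite size_rem.
have ra : rem a [:: a, b & s] = b :: s by rewrite [LHS]/= eqxx.
have rc : rem c [:: a, b & s] = a :: rem c (b :: s) by rewrite [LHS]/= (negPf ac).
apply: (@polarize_affine0 _ (size [:: a, b & s]) a c t (u :: rem c (b :: s)) f ac).
  rewrite -(h c u) ?rc; last by rewrite inE cs orbT.
  apply: polarize_perm; last by rewrite /= sc.
  by rewrite -(cat1s a) -(cat1s u) perm_catCA.
rewrite -(h a u (mem_head _ _)) ra; apply: polarize_perm; last by rewrite /= sc.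
by rewrite -(cat1s c) -(cat1s u) perm_catCA perm_cons perm_sym perm_to_rem.
Qed.

(** * Multiplicities under polar derivatives with real poles *)

Lemma mup_factor (F : fieldType) (c : F) (f : {poly F}) : f != 0 ->
  exists2 h : {poly F}, h.[c] != 0 & f = ('X - c%:P) ^+ mup c f * h.
Proof.
move=> f0; have [m [h /implyP/(_ f0) hc e]] := multiplicity_XsubC f c.
exists h => //; suff -> : mup c f = m by rewrite mulrC.
by rewrite e mupMr // mup_XsubCX eqxx.
Qed.

Lemma mup_XsubC_exp_mul (F : fieldType) (c : F) (m : nat) (h : {poly F}) :
  h.[c] != 0 -> mup c (('X - c%:P) ^+ m * h) = m.
Proof. by move=> hc; rewrite mupMl // mup_XsubCX eqxx. Qed.

Lemma horner_deriv2_prod (F : fieldType) (s : seq F) (z : F) : z \notin s ->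
  (\prod_(x <- s) ('X - x%:P))^`()^`().[z] =
  (\prod_(x <- s) ('X - x%:P)).[z] *
  ((\sum_(x <- s) (z - x)^-1) ^+ 2 - \sum_(x <- s) (z - x)^-1 ^+ 2).
Proof.
elim: s => [|a s IH].
  by rewrite !big_nil derivC derivC horner0 expr0n subrr mulr0.
rewrite inE negb_or => /andP[za zs]; have {}IH := IH zs.
rewrite !big_cons derivM derivXsubC mul1r derivD derivM derivXsubC mul1r.
rewrite !hornerD !hornerM IH (horner_deriv_prod zs) hornerXsubC.
have za0 : z - a != 0 by rewrite subr_eq0.
by field.
Qed.

Lemma polar_deriv_XsubC_exp (F : numFieldType) (D : nat) (b k : F) :
  polar_deriv D b (k *: ('X - b%:P) ^+ D) = 0.
Proof.
case: D => [|D]; rewrite /polar_deriv derivZ.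
  by rewrite expr0 derivC scaler0 mulr0 mulr0n subrr.
rewrite deriv_exp derivXsubC mul1r /= -scalerAr mulrnAr -exprS.
by rewrite scalerMnr subrr.
Qed.

Lemma cpoly_polar_deriv (R : rcfType) (D : nat) (b : R) (f : {poly R}) :
  cpoly (polar_deriv D b f) = polar_deriv D (real_complex R b) (cpoly f).
Proof. by rewrite /cpoly /polar_deriv rmorphB rmorphM rmorphMn /= map_polyXsubC deriv_map. Qed.

Lemma cpoly_inj (R : rcfType) : injective (@cpoly R).
Proof. exact: map_poly_inj. Qed.

(** For a pole on the real line the only exception in Laguerre's theorem is a multiple of the [D]-th
    power of ['X - b%:P], whose polar derivative is zero. *)
Lemma upper_stable_polar_deriv_real (R : rcfType) (D : nat) (b : R) (f : {poly R}) :
  upper_stable (cpoly f) -> (size f <= D.+1)%N -> polar_deriv D b f != 0 ->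
  upper_stable (cpoly (polar_deriv D b f)).
Proof.
move=> hf sf g0 z hz; apply: contraNneq g0; rewrite cpoly_polar_deriv.
have sf' : (size (cpoly f) <= D.+1)%N by rewrite size_map_poly.
have b0 : 0 <= 'Im (real_complex R b) by rewrite Im_real_complex.
case/(polar_deriv_halfplane hf sf' b0 hz) => k e; apply/eqP/cpoly_inj.
by rewrite cpoly_polar_deriv e polar_deriv_XsubC_exp /cpoly rmorph0.
Qed.

(** The squared deviations from [W] sum to [(size s - D) * W ^+ 2], which is nonpositive. *)
Lemma sum_inv_real (R : rcfType) (D : nat) (s : seq R) (W : R) :
  (size s <= D)%N -> W != 0 -> \sum_(x <- s) x = D%:R * W ->
  \sum_(x <- s) x ^+ 2 = D%:R * W ^+ 2 -> s = nseq D W.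
Proof.
move=> sD W0 e1 e2; have W2 : 0 < W ^+ 2 by rewrite exprn_even_gt0.
have key : \sum_(x <- s) (x - W) ^+ 2 = ((size s)%:R - D%:R) * W ^+ 2.
  under eq_bigr => x _ do rewrite sqrrB.
  rewrite big_split /= sumrB e2 sumrMnl -mulr_suml e1.
  by rewrite big_const_seq count_predT iter_addr_0 -[W ^+ 2 *+ _]mulr_natl; ring.
have n0 : (0 <= \sum_(x <- s) (x - W) ^+ 2) by apply: sumr_ge0 => x _; rewrite sqr_ge0.
have /eqP slD : size s == D.
  by rewrite eqn_leq sD /= -(ler_nat R) -subr_ge0 -(pmulr_lge0 _ W2) -key.
move/eqP: key; rewrite slD subrr mul0r psumr_eq0; last by move=> x _; rewrite sqr_ge0.
move=> /allP h; rewrite -slD; apply/all_pred1P/allP => x xs.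
by have := h x xs; rewrite /= sqrf_eq0 subr_eq0.
Qed.

(* With [w_x = 1 / (c - x)] over the roots [x] of [f] and [W = 1 / (c - b)], a double zero at
   [c] means [sum w_x = D W] and [sum w_x^2 = D W^2]: equality in Cauchy-Schwarz. *)
Lemma polar_deriv_no_new_double_root (R : rcfType) (D : nat) (b c : R) (f : {poly R}) :
  upper_stable (cpoly f) -> (size f <= D.+1)%N -> b != c -> f.[c] != 0 ->
  (polar_deriv D b f).[c] = 0 -> (polar_deriv D b f)^`().[c] = 0 -> polar_deriv D b f = 0.
Proof.
move=> hf sf bc fc; have [s fs] := split_upper_stable hf.
set k := lead_coef f in fs; have k0 : k != 0.
  by rewrite lead_coef_eq0; apply: contraNneq fc => ->; rewrite horner0.
have cs : c \notin s.
  apply: contraNN fc; rewrite -root_prod_XsubC fs hornerZ => /rootP ->.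
  by rewrite mulr0.
have cb : c - b != 0 by rewrite subr_eq0 eq_sym.
move=> g0 g1; suff es : s = nseq D b.
  by rewrite fs es /split_poly big_nseq iter_mulr_1; apply: polar_deriv_XsubC_exp.
move: g0 g1; rewrite /polar_deriv derivB derivM derivXsubC mul1r derivMn !hornerE !hornerMn.
have := horner_deriv2_prod cs; have := horner_deriv_prod cs.
rewrite -/(split_poly s); move: fc.
rewrite fs !derivZ !hornerZ; set P := (split_poly s).[c].
set S1 := \sum_(x <- s) _; set S2 := \sum_(x <- s) _ => P0 -> -> e1 e2.
have {}P0 : P != 0 by apply: contraNneq P0 => ->; rewrite mulr0.
have kP : k * P != 0 by rewrite mulf_neq0.
have h1 : S1 = D%:R * (c - b)^-1.
  apply: (mulIf cb); rewrite mulfVK //; apply: (mulfI kP).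
  move: e1; rewrite -mulr_natr => /eqP; rewrite subr_eq0 => /eqP e1.
  by rewrite e1; ring.
have h2 : S2 = D%:R * (c - b)^-1 ^+ 2.
  (* The vanishing derivative of the polar derivative, divided by the value of [f] at [c]. *)
  have : (D%:R - 1) * S1 = (c - b) * (S1 ^+ 2 - S2).
    apply: (mulfI kP); move: e2; rewrite -mulr_natr => e2.
    by apply/eqP; rewrite -subr_eq0 -[X in _ == X]e2; apply/eqP; ring.
  rewrite h1 => e3.
  have : S2 = (D%:R * (c - b)^-1) ^+ 2 - (D%:R - 1) * (D%:R * (c - b)^-1) / (c - b).
    by rewrite e3; field.
  by move=> ->; ring.
have : [seq (c - x)^-1 | x <- s] = nseq D (c - b)^-1.
  apply: sum_inv_real; rewrite ?big_map ?size_map ?invr_eq0 //.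
  by rewrite -ltnS (leq_trans _ sf) // fs size_scale // size_prod_XsubC.
move=> e; have inj : injective (fun x => (c - x)^-1) by move=> x y /invr_inj /addrI /oppr_inj.
by apply: (inj_map inj); rewrite e map_nseq.
Qed.

Lemma mup_polar_deriv_pole (F : numFieldType) (D : nat) (b : F) (f : {poly F}) :
  f != 0 -> mup b f != D -> mup b (polar_deriv D b f) = mup b f /\ polar_deriv D b f != 0.
Proof.
move=> f0 mD; have [h hb fE] := mup_factor b f0; set m := mup b f in fE mD *.
pose g := (D%:R - m%:R)%:P * h - ('X - b%:P) * h^`().
have -> : polar_deriv D b f = ('X - b%:P) ^+ m * g.
  rewrite polar_deriv_polyC [in LHS]fE derivM deriv_exp derivXsubC mul1r /g polyCB.
  case: (m) => [|n] /=; first by rewrite mulr0n expr0; ring.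
  by rewrite exprS -[_ *+ n.+1]mulr_natl -[n.+1%:R]polyC_natr; ring.
have gb : g.[b] != 0.
  rewrite /g hornerD hornerN !hornerM hornerXsubC subrr mul0r subr0 hornerC.
  by rewrite mulf_neq0 // subr_eq0 eqr_nat eq_sym.
rewrite mup_XsubC_exp_mul //; split=> //.
apply: contraNneq gb => /eqP; rewrite mulf_eq0 expf_eq0 polyXsubC_eq0 andbF => /eqP ->.
by rewrite horner0.
Qed.

Lemma mup_polar_deriv_root (F : numFieldType) (D : nat) (b c : F) (f : {poly F}) :
  f != 0 -> b != c -> root f c -> mup c f = (mup c (polar_deriv D b f)).+1.
Proof.
move=> f0 bc rc; have [h hc fE] := mup_factor c f0.
move: fE; have : (0 < mup c f)%N by rewrite -XsubC_dvd // -root_factor_theorem.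
case: (mup c f) => // m _ fE; congr _.+1.
pose g := ('X - c%:P) * (D%:R%:P * h - ('X - b%:P) * h^`()) - m.+1%:R%:P * ('X - b%:P) * h.
have -> : polar_deriv D b f = ('X - c%:P) ^+ m * g.
  rewrite polar_deriv_polyC fE derivM deriv_exp derivXsubC mul1r /g /=.
  by rewrite exprS -[_ *+ m.+1]mulr_natl -[m.+1%:R]polyC_natr; ring.
rewrite mup_XsubC_exp_mul // /g hornerD hornerN !hornerM !hornerXsubC subrr mul0r sub0r hornerC.
by rewrite oppr_eq0 !mulf_neq0 ?pnatr_eq0 // subr_eq0 eq_sym.
Qed.

(** Induction on the poles, undoing one polar derivative with pole [b]. At [b] the multiplicity is
    kept while [b] counts once more as a pole; at another root of [f] the multiplicity was one
    higher; a point that is not a root of [f] cannot become a double root. Each time the bound keeps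
    pace with the degree. *)
Lemma polarize_eq0_mult (R : rcfType) (D : nat) (s : seq R) (f : {poly R}) :
  upper_stable (cpoly f) -> (size f <= D.+1)%N -> (size s < D)%N -> polarize D s f = 0 ->
  exists2 c, c \in s & (D < mup c f + count_mem c s)%N.
Proof.
elim: s D f => [|b s IH] [|D] f hf sf //= sD.
  by move=> f0; have := hf 'i; rewrite Im_i f0 /cpoly rmorph0 horner0 eqxx ltr01 => /(_ isT).
have f0 : f != 0.
  have := hf 'i; rewrite Im_i ltr01 => /(_ isT).
  by apply: contraNneq => ->; rewrite /cpoly rmorph0 horner0.
move=> gs; have [mD | mD] := eqVneq (mup b f) D.+1.
  by exists b; rewrite ?mem_head // eqxx mD; lia.
have [mb g0] := mup_polar_deriv_pole f0 mD.
have [c cs hc] := IH _ _ (upper_stable_polar_deriv_real hf sf g0) (size_polar_deriv b sf) sD gs.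
exists c; first by rewrite inE cs orbT.
have [bc | bc] := eqVneq b c.
  by rewrite -bc mb in hc *; rewrite addnCA ltnS.
have [rc | rc] := boolP (root f c).
  by rewrite add0n (mup_polar_deriv_root D.+1 f0 bc rc) addSn ltnS.
(* There are fewer than [D] poles left, so [c] accounts for at most [D - 1] of them and its
   multiplicity must supply at least 2. *)
have : (1 < mup c (polar_deriv D.+1 b f))%N.
  rewrite ltnNge; apply/negP => h; move: (leq_trans hc (leq_add h (count_size _ s))).
  by rewrite add1n !ltnS leqNgt -ltnS sD.
rewrite mup_geq // => /dvdpP[h gE].
have g0c : (polar_deriv D.+1 b f).[c] = 0.
  by rewrite gE hornerM horner_exp hornerXsubC subrr expr0n mulr0.
have g1c : (polar_deriv D.+1 b f)^`().[c] = 0.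
  rewrite gE derivM deriv_exp derivXsubC expr1 mul1r hornerD !hornerM hornerMn.
  by rewrite hornerXsubC subrr mul0rn !mulr0 addr0.
by rewrite (polar_deriv_no_new_double_root hf sf bc rc g0c g1c) eqxx in g0.
Qed.

(** * Double roots force an atom triplet *)

Lemma horner_all0 (F : numFieldType) (p : {poly F}) : (forall y, p.[y] = 0) -> p = 0.
Proof.
move=> h; apply/eqP; apply/negPn/negP => p0.
have := @max_poly_roots _ p [seq n%:R | n <- iota 0 (size p)] p0.
rewrite size_map size_iota ltnn map_inj_uniq ?iota_uniq; last first.
  by move=> m n /eqP; rewrite eqr_nat => /eqP.
by move=> H; apply/notF/H => //; apply/allP => x _; apply/rootP.
Qed.

Lemma split_poly_perm (R : rcfType) (s t : seq R) : perm_eq s t -> split_poly s = split_poly t.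
Proof. exact: perm_big. Qed.

Lemma size_split_poly (R : rcfType) (s : seq R) : size (split_poly s) = (size s).+1.
Proof. exact: size_prod_XsubC. Qed.

Lemma split_poly_monic (R : rcfType) (s : seq R) : split_poly s \is monic.
Proof. exact: monic_prod_XsubC. Qed.

Lemma ffconv_split_monic (R : rcfType) (s t : seq R) : (size s <= size t)%N ->
  ffconv (size t) (split_poly s) (split_poly t) \is monic /\
  size (ffconv (size t) (split_poly s) (split_poly t)) = (size s).+1.
Proof.
move=> st; rewrite -size_split_poly.
by apply: ffconv_monic; rewrite ?split_poly_monic ?size_split_poly ?ltnS.
Qed.

(** Otherwise the Herglotz quotient would be finite at [x], where its zero has order at most one. *)
Lemma ffconv_rem_root (R : rcfType) (a x : R) (s t : seq R) :
  a \in s -> (size s <= size t)%N ->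
  (1 < mup x (ffconv (size t) (split_poly s) (split_poly t)))%N ->
  (ffconv (size t) (split_poly (rem a s)) (split_poly t)).[x] = 0.
Proof.
move=> as_ st; set r := ffconv _ _ _; set w := ffconv _ _ _ => xr.
have r0 : r != 0 by have [/monic_neq0] := ffconv_split_monic st.
have [h hx rE] := mup_factor x r0.
apply/eqP; apply: contraLR xr => wx; rewrite -leqNgt.
have := @herglotz_at_root R (mup x r) x h w; rewrite -rE => H; apply H.
  rewrite /r (split_poly_perm (perm_to_rem as_)); apply: ffconv_herglotz => //.
  by rewrite size_rem // (leq_trans _ st) // prednK //; case: (s) as_.
by rewrite mulf_neq0.
Qed.

Lemma ffconv_double_root (R : rcfType) (x : R) (s t : seq R) : size s = size t ->
  (1 < mup x (ffconv (size t) (split_poly s) (split_poly t)))%N ->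
  exists a b, [/\ a \in s, b \in t, x = a + b & (size t < count_mem a s + count_mem b t)%N].
Proof.
move=> st xr; set d := size t in st xr *; set q := split_poly t in xr *.
have sq : (size q <= d.+1)%N by rewrite size_split_poly.
have r0 : ffconv d (split_poly s) q != 0.
  have [|/monic_neq0 //] := @ffconv_split_monic R s t; first by rewrite st.
pose S := [seq x - a | a <- s].
(* Replacing the pole [x - a] by [u] means replacing the root [a] by [x - u]. The new polynomial is
   a combination of [split_poly s] and [split_poly (rem a s)], whose convolutions with [q] both
   vanish at [x]. *)
have polS a u : a \in s -> polarize d (u :: [seq x - b | b <- rem a s]) q = 0.
  move=> as_; apply: horner_all0 => y.
  have -> : u :: [seq x - b | b <- rem a s] = [seq x - b | b <- (x - u) :: rem a s].
    by rewrite /= subKr.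
  have sr : size ((x - u) :: rem a s) = d.
    by rewrite /= size_rem // prednK //; case: (s) as_.
  rewrite (polarize_ffconv _ _ sq sr) -/(split_poly _) ffconvC // ?size_split_poly ?sr //.
  have -> : split_poly ((x - u) :: rem a s) =
      (a - (x - u)) *: split_poly (rem a s) + split_poly s.
    rewrite (split_poly_perm (perm_to_rem as_)) /split_poly !big_cons -mul_polyC -mulrDl.
    by congr (_ * _); ring.
  rewrite ffconvDl hornerD hornerZ ffconv_rem_root ?st // mulr0 add0r.
  have := @mup_geq _ x _ 1%N r0; rewrite (ltnW xr) => /esym.
  by rewrite expr1 -root_factor_theorem => /rootP ->; rewrite mulr0.
(* [U] holds one copy of each distinct pole and [s0] the remaining copies. Interpolation over the
   distinct poles [U] shows that polarizing at [s0] alone already gives zero, and [s0] is shorter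
   than [d]. *)
have [s0 hs0] := perm_to_subseq (undup_subseq S); set U := undup S in hs0.
have sS : (size U + size s0 = d)%N by rewrite -size_cat -(perm_size hs0) size_map.
have d0 : (0 < d)%N.
  have /root_size_gt1 : root (ffconv d (split_poly s) q) x.
    by rewrite root_factor_theorem XsubC_dvd // ltnW.
  have [|_ ->] := @ffconv_split_monic R s t; first by rewrite st.
  by rewrite st ltnS; apply.
have U0 : U != [::].
  apply: contraTneq d0 => /undup_nil S0.
  by rewrite -st -[size s](size_map (fun a => x - a)) -/S S0.
have hx : upper_stable (cpoly q) := @upper_stable_split R t.
have g0 : polarize d s0 q = 0.
  apply: (polarize_interpolation U0 (undup_uniq S)) => c u cU.
  have sD : (size U = d - size s0)%N by rewrite -sS addnK.
  have cS : c \in S by rewrite -mem_undup.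
  have /mapP[a as_ ca] := cS.
  rewrite [in LHS]sD -polarize_cat -(polS a u as_); apply: polarize_perm.
    rewrite -cat1s perm_catCA /= perm_cons -(perm_cons c).
    have e1 : perm_eq (c :: s0 ++ rem c U) S.
      rewrite perm_sym (perm_trans hs0) // perm_catC -cat1s perm_sym perm_catCA perm_cat2l.
      by rewrite perm_sym; apply: perm_to_rem.
    rewrite (perm_trans e1) // ca -[_ :: _]/([seq x - b | b <- a :: rem a s]).
    exact/perm_map/perm_to_rem.
  by rewrite size_cat /= size_rem // prednK ?lt0n ?size_eq0 // addnC sS.
have s0d : (size s0 < d)%N by rewrite -sS -[ltnLHS]add0n ltn_add2r lt0n size_eq0.
have [c cs0 hc] := polarize_eq0_mult hx sq s0d g0.
have cS : c \in S by rewrite (perm_mem hs0) mem_cat cs0 orbT.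
have /mapP[a as_ ca] := cS.
have mc : mup c q = count_mem c t by exact: mu_prod_XsubC.
exists a, c; split => //; last 1 first.
- apply: (leq_trans hc); rewrite mc addnC leq_add2r.
  have -> : count_mem a s = count_mem c S.
    rewrite count_map; apply: eq_count => b /=.
    by rewrite ca (inj_eq (addrI x)) eqr_opp.
  by rewrite (permP hs0) count_cat leq_addl.
- rewrite -has_pred1 has_count -mc lt0n; apply: contraTneq hc => ->.
  by rewrite add0n -leqNgt ltnW // (leq_ltn_trans (count_size _ _)).
- by rewrite ca addrCA subrr addr0.
Qed.

(** * Counting roots *)

Definition ngt (R : rcfType) (x : R) (s : seq R) : nat := count (fun y => x < y) s.
Definition nlt (R : rcfType) (x : R) (s : seq R) : nat := count (fun y => y < x) s.

Lemma size_trichotomy (R : rcfType) (x : R) (s : seq R) :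
  size s = (count_mem x s + (ngt x s + nlt x s))%N.
Proof.
rewrite /ngt /nlt; elim: s => //= y s ->.
by case: (ltgtP x y) => _ /=; lia.
Qed.

Lemma sgr_split_poly (R : rcfType) (x : R) (s : seq R) :
  x \notin s -> Num.sg (split_poly s).[x] = (-1) ^+ ngt x s.
Proof.
rewrite /split_poly /ngt; elim: s => [|y s IH] /=; first by rewrite big_nil hornerC sgr1.
rewrite inE negb_or => /andP[xy /IH {}IH]; rewrite big_cons hornerM sgrM IH hornerXsubC.
rewrite exprD; congr (_ * _); case: ltgtP xy => // h _.
  by rewrite ltr0_sg ?subr_lt0 // expr1.
by rewrite gtr0_sg ?subr_gt0 // expr0.
Qed.

Lemma ngt_next (R : rcfType) (x : R) (s : seq R) : uniq s -> (0 < ngt x s)%N ->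
  exists2 y, y \in s & x < y /\ ngt x s = (ngt y s).+1.
Proof.
move=> us; rewrite -has_count => /hasP[y0 y0s xy0].
have [y [ys xy ymin]] : exists y, [/\ y \in s, x < y & forall z, z \in s -> x < z -> y <= z].
  elim: (s) y0 y0s xy0 => // a l IH y0 y0s xy0.
  have [/hasP[y1 y1l xy1]|/hasPn nl] := boolP (has (fun y => x < y) l).
    have [y [yl xy ymin]] := IH _ y1l xy1.
    have [xa|ax] := ltP x a; last first.
      exists y; split; rewrite ?inE ?yl ?orbT // => z; rewrite inE => /predU1P[->|/ymin //].
      by rewrite ltNge ax.
    have [ya|ay] := leP y a.
      by exists y; split; rewrite ?inE ?yl ?orbT // => z; rewrite inE => /predU1P[->|/ymin].
    exists a; split; rewrite ?mem_head // => z; rewrite inE => /predU1P[->//|/ymin yz /yz].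
    by apply: le_trans; apply: ltW.
  move: y0s; rewrite inE => /predU1P[y0a|/nl]; last by rewrite xy0.
  exists a; split; rewrite ?mem_head -?y0a // => z; rewrite inE => /predU1P[->//|/nl].
  by move=> /negPf ->.
exists y => //; split => //; have cy : count_mem y s = 1%N by rewrite count_uniq_mem ?ys.
rewrite /ngt -[RHS]add1n -cy -[RHS]count_predUI.
rewrite [X in (_ + X)%N](@eq_count _ _ pred0) ?count_pred0 ?addn0; last first.
  by move=> z /=; case: eqP => // ->; rewrite ltxx.
apply: eq_in_count => z zs /=; rewrite eq_sym -le_eqVlt.
by apply/idP/idP => [/(ymin z zs)|/(lt_le_trans xy)].
Qed.

(** From the largest element of [s] downwards, [ngt y s] rises by one at each element, so by parity
    [ngt y t] must change too, and it can only grow. Hence [ngt y s <= ngt y t] on [s], and [x] lies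
    at most one element further. *)
Lemma ngt_parity_le (R : rcfType) (s t : seq R) (x : R) : uniq s ->
  {in s, forall y, odd (ngt y s) = odd (ngt y t)} -> (ngt x s <= (ngt x t).+1)%N.
Proof.
move=> us par.
have mono a b : a <= b -> (ngt b t <= ngt a t)%N.
  by move=> ab; apply: sub_count => y /=; apply: le_lt_trans.
have key n : forall y, y \in s -> ngt y s = n -> (n <= ngt y t)%N.
  elim: n => // n IH y ys yn.
  have [|z zs [yz e]] := @ngt_next R y s us; first by rewrite yn.
  have zn : ngt z s = n by move: e; rewrite yn => -[].
  have := leq_trans (IH z zs zn) (mono _ _ (ltW yz)).
  rewrite leq_eqVlt => /predU1P[e2|//].
  by have := par y ys; rewrite yn -e2 /=; case: odd.
case: (posnP (ngt x s)) => [->//|/(ngt_next us)[y ys [xy ->]]].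
by rewrite ltnS (leq_trans (key _ y ys erefl)) // mono // ltW.
Qed.

Lemma nlt_ngt_opp (R : rcfType) (x : R) (s : seq R) :
  nlt x s = ngt (- x) [seq - y | y <- s].
Proof. by rewrite /nlt /ngt count_map; apply: eq_count => y /=; rewrite ltrN2. Qed.

Lemma ngt_cons (R : rcfType) (x a : R) (s : seq R) : ngt x (a :: s) = ((x < a)%R + ngt x s)%N.
Proof. by []. Qed.

Lemma nlt_cons (R : rcfType) (x a : R) (s : seq R) : nlt x (a :: s) = ((a < x)%R + nlt x s)%N.
Proof. by []. Qed.

Lemma ngt_perm (R : rcfType) (x : R) (s t : seq R) : perm_eq s t -> ngt x s = ngt x t.
Proof. by move/permP; apply. Qed.

Lemma nlt_perm (R : rcfType) (x : R) (s t : seq R) : perm_eq s t -> nlt x s = nlt x t.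
Proof. by move/permP; apply. Qed.

(** * Interlacing of root counts *)

(** A common real root only contributes the positive factor given by the squared modulus of
    [z - a]. *)
Lemma herglotz_cons (R : rcfType) (a : R) (s t : seq R) :
  herglotz (split_poly (a :: s)) (split_poly (a :: t)) ->
  herglotz (split_poly s) (split_poly t).
Proof.
move=> H z hz; have := H z hz; rewrite /split_poly !big_cons -!/(split_poly _).
rewrite /cpoly !rmorphM /= !hornerM rmorphM mulrACA -normCK ImMl ?rpredX ?normr_real //=.
rewrite pmulr_rgt0 // exprn_gt0 // normr_gt0 map_polyXsubC hornerXsubC subr_eq0.
by apply: contraTneq hz => ->; rewrite Im_real_complex ltxx.
Qed.

(** Common roots are cancelled first. Every remaining root of [s] is then simple with a positive
    leading coefficient in the quotient, which fixes the parity of the number of roots of [t] above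
    it. *)
Lemma herglotz_interlace (R : rcfType) (s t : seq R) (x : R) :
  size s = (size t).+1 -> herglotz (split_poly s) (split_poly t) ->
  (ngt x s <= (ngt x t).+1)%N /\ (nlt x s <= (nlt x t).+1)%N.
Proof.
have [n] := ubnP (size s); elim: n s t => // n IH s t sn st H.
have [/hasP[a as_ at_]|/hasPn dis] := boolP (has (mem t) s).
  have ps := perm_to_rem as_; have pt := perm_to_rem at_.
  have [] := IH (rem a s) (rem a t).
  - by move: sn; rewrite (perm_size ps).
  - by move: st; rewrite (perm_size ps) (perm_size pt) => -[].
  - by move: H; rewrite (split_poly_perm ps) (split_poly_perm pt) => /herglotz_cons.
  rewrite (ngt_perm _ ps) (ngt_perm _ pt) (nlt_perm _ ps) (nlt_perm _ pt).
  by rewrite !ngt_cons !nlt_cons; lia.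
have at_root y : y \in s -> count_mem y s = 1%N /\ odd (ngt y s) = odd (ngt y t).
  move=> ys; have yt : y \notin t by apply: dis.
  have wy : (split_poly t).[y] != 0 by rewrite -rootE root_prod_XsubC.
  have [h hy sE] := mup_factor y (monic_neq0 (split_poly_monic s)).
  have := @herglotz_at_root R (mup y (split_poly s)) y h (split_poly t).
  rewrite -sE mulf_neq0 // => /(_ H isT).
  have mE : mup y (split_poly s) = count_mem y s by exact: mu_prod_XsubC.
  rewrite mE => -[c1 c2]; have c0 : (0 < count_mem y s)%N by rewrite -has_count has_pred1.
  have c1' : count_mem y s = 1%N by apply/eqP; rewrite eqn_leq c1.
  split=> //; have := c2 c1'.
  have hE : h = split_poly (rem y s).
    have y0 : 'X - y%:P != 0 by rewrite polyXsubC_eq0.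
    apply: (mulfI y0); rewrite -[in LHS](expr1 ('X - _)) -c1' -mE -sE.
    by rewrite (split_poly_perm (perm_to_rem ys)) /split_poly big_cons.
  have yr : y \notin rem y s.
    rewrite -has_pred1 has_count -leqNgt; move: c1'.
    by rewrite (permP (perm_to_rem ys)) /= eqxx add1n => -[->].
  rewrite hE -sgr_gt0 sgrM !sgr_split_poly // -exprD -signr_odd oddD.
  rewrite (ngt_perm y (perm_to_rem ys)) ngt_cons ltxx add0n.
  by case: (odd _); case: (odd _) => //=; rewrite expr1 ltr0N1.
have us : uniq s.
  apply: count_mem_uniq => y; have [ys|/count_memPn //] := boolP (y \in s).
  by have [] := at_root y ys.
split; first by apply: ngt_parity_le => // y ys; have [] := at_root y ys.
(* The count below is the count above after reflection; its parity follows from the total sizes, as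
   [y] is simple in [s] and absent from [t]. *)
rewrite !nlt_ngt_opp; apply: ngt_parity_le; first by rewrite (map_inj_uniq oppr_inj).
move=> _ /mapP[y ys ->]; rewrite -!nlt_ngt_opp; have [c1 par] := at_root y ys.
have ct : count_mem y t = 0%N by apply/count_memPn; apply: dis.
move: st; rewrite (size_trichotomy y s) (size_trichotomy y t) c1 ct add1n add0n => -[].
by move/(congr1 odd); rewrite !oddD par => /addbI.
Qed.

(** * Local expansion of the convolution at an atom *)

Lemma derivn_XsubC_exp_mul (F : numFieldType) (a : F) (m j : nat) (h : {poly F}) :
  (j <= m)%N -> exists u, (('X - a%:P) ^+ m * h)^`(j) =
    ('X - a%:P) ^+ (m - j) * ((m ^_ j)%:R%:P * h + ('X - a%:P) * u).
Proof.
elim: j => [|j IH] jm.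
  by exists 0; rewrite subn0 ffactn0 mulr0 addr0 polyC1 mul1r.
have [u e] := IH (ltnW jm); have mj : (m - j = (m - j.+1).+1)%N by lia.
exists ((m ^_ j)%:R%:P * h^`() + ((m - j.+1).+1%:R%:P + 1) * u + ('X - a%:P) * u^`()).
rewrite derivnS e ffactnSr mj natrM polyCM; set k := (m - j.+1)%N.
rewrite derivM deriv_exp derivXsubC derivD !derivM derivXsubC derivC mul1r /=.
by rewrite exprS -[_ *+ k.+1]mulr_natl -[k.+1%:R]polyC_natr; ring.
Qed.

Lemma horner_derivn_XsubC_exp (F : numFieldType) (a : F) (n j : nat) (h : {poly F}) :
  (j <= n)%N -> (('X - a%:P) ^+ n * h)^`(j).[a] = if j == n then n`!%:R * h.[a] else 0.
Proof.
move=> jn; have [u ->] := derivn_XsubC_exp_mul a h jn.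
rewrite hornerM horner_exp hornerXsubC subrr hornerD !hornerM hornerC hornerXsubC subrr.
rewrite mul0r addr0; case: eqP => [->|/eqP ne]; first by rewrite subnn ffactnn expr0 mul1r.
by rewrite expr0n subn_eq0 leqNgt ltn_neqAle ne jn mul0r.
Qed.

Lemma ffconv_shift (F : numFieldType) (d : nat) (p q : {poly F}) (b : F) :
  (size p <= d.+1)%N -> (size q <= d.+1)%N ->
  ffconv d p q =
  \sum_(k < d.+1) (q^`(d - k).[b] / d`!%:R) *: (p^`(k) \Po ('X - b%:P)).
Proof.
move=> sp sq; apply/eqP; rewrite -subr_eq0; apply/eqP/horner_all0 => z.
apply/eqP; rewrite hornerD hornerN subr_eq0; apply/eqP.
apply: (mulfI (natr_fact_neq0 F d)); rewrite (horner_ffconv_shift z b sp sq).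
rewrite horner_sum mulr_sumr; apply: eq_bigr => k _.
rewrite hornerZ horner_comp hornerXsubC; field; exact: natr_fact_neq0.
Qed.

(** Recentred at [b], the terms of index above [d - n] vanish, and the term of index [i <= d - n] is
    divisible by the power [m - i] of ['X - (a + b)%:P]. The minimal power [m + n - d] arises only
    from [i = d - n], which alone determines [h] at [a + b]. *)
Lemma ffconv_atom (F : numFieldType) (d m n : nat) (a b : F) (p q : {poly F}) :
  (m <= d)%N -> (n <= d)%N -> (d <= m + n)%N ->
  (size (('X - a%:P) ^+ m * p)%R <= d.+1)%N -> (size (('X - b%:P) ^+ n * q)%R <= d.+1)%N ->
  exists h k, [/\ 0 < k, h.[a + b] = k * (p.[a] * q.[b]) &
    ffconv d (('X - a%:P) ^+ m * p) (('X - b%:P) ^+ n * q) =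
    ('X - (a + b)%:P) ^+ (m + n - d) * h].
Proof.
move=> md nd dmn sp sq; rewrite (ffconv_shift b sp sq).
set e := (m + n - d)%N; pose k := n`!%:R / d`!%:R * (m ^_ (d - n))%:R : F.
(* Divisibility with a prescribed value of the cofactor at [a + b] is stable under sums, so each
   term can be treated separately. *)
pose K (T : {poly F}) (v : F) := exists2 h, h.[a + b] = v & T = ('X - (a + b)%:P) ^+ e * h.
pose v (i : 'I_d.+1) := if (i == d - n :> nat)%N then k * (p.[a] * q.[b]) else 0.
set T := \sum_(i < d.+1) _.
have : K T (\sum_i v i).
  apply: (big_ind2 K).
  - by exists 0; rewrite ?horner0 ?mulr0.
  - move=> T1 v1 T2 v2 [h1 <- ->] [h2 <- ->]; exists (h1 + h2); first by rewrite hornerD.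
    by rewrite mulrDr.
  move=> i _; have id : (i <= d)%N by rewrite -ltnS.
  have [ni|ni] := ltnP (d - n) i.
    have din : (d - i < n)%N by lia.
    rewrite horner_derivn_XsubC_exp ?(ltnW din) // (ltn_eqF din) mul0r scale0r.
    by exists 0; rewrite ?mulr0 // horner0 /v gtn_eqF.
  have im : (i <= m)%N by lia.
  have [u ->] := derivn_XsubC_exp_mul a p im.
  set c := _ / _; set g := _ + _ * u.
  have ga : (g \Po ('X - b%:P)).[a + b] = (m ^_ i)%:R * p.[a].
    rewrite horner_comp hornerXsubC addrK /g hornerD !hornerM hornerC hornerXsubC.
    by rewrite subrr mul0r addr0.
  exists (c *: (('X - (a + b)%:P) ^+ (d - n - i) * (g \Po ('X - b%:P)))).
    rewrite hornerZ hornerM horner_exp hornerXsubC subrr ga /c /v.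
    have [ie | ne] := eqVneq (i : nat) (d - n)%N.
      have din : (d - i = n)%N by lia.
      rewrite din horner_derivn_XsubC_exp // eqxx ie subnn expr0 mul1r /k.
      by field; rewrite natr_fact_neq0.
    by rewrite expr0n (_ : (d - n - i == 0)%N = false) ?mul0r ?mulr0 //; lia.
  rewrite rmorphM rmorphXn /= comp_polyB comp_polyX comp_polyC -scalerAr mulrA -exprD.
  rewrite (_ : (e + (d - n - i))%N = (m - i)%N); last by rewrite /e; lia.
  by rewrite polyCD; congr (_ *: (_ ^+ _ * _)); ring.
rewrite (bigD1 (Ordinal (leq_subr n d : (d - n < d.+1)%N))) //= big1; last first.
  by move=> i /eqP ne; rewrite /v; case: eqP => // e0; case: ne; apply: val_inj.
rewrite /v eqxx addr0 => -[h hE TE]; exists h, k; split=> //.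
rewrite /k mulr_gt0 ?divr_gt0 ?ltr0n ?fact_gt0 // ffact_gt0; lia.
Qed.

Lemma split_poly_filter (R : rcfType) (a : R) (s : seq R) :
  split_poly s = ('X - a%:P) ^+ count_mem a s * split_poly (filter (predC1 a) s).
Proof.
rewrite /split_poly; elim: s => [|b s IH] /=; first by rewrite big_nil mulr1.
rewrite big_cons IH; case: eqVneq => [->|ba] /=; first by rewrite exprS mulrA.
by rewrite big_cons mulrCA.
Qed.

Lemma ngt_filter (R : rcfType) (a : R) (s : seq R) : ngt a (filter (predC1 a) s) = ngt a s.
Proof.
rewrite /ngt count_filter; apply: eq_count => x /=.
by case: ltgtP.
Qed.

(** The cofactor at [a + b] is nonzero, giving the multiplicity, and has the sign of the product of
    the cofactors at [a] and [b], giving the parity. Equality in the second hypothesis is allowed;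
    [a + b] is then not a root. *)
Lemma ffconv_atom_split (R : rcfType) (a b : R) (s t r : seq R) :
  (size s <= size t)%N -> (size t <= count_mem a s + count_mem b t)%N ->
  ffconv (size t) (split_poly s) (split_poly t) = split_poly r ->
  count_mem (a + b) r = (count_mem a s + count_mem b t - size t)%N /\
  odd (ngt (a + b) r) = odd (ngt a s + ngt b t).
Proof.
move=> st mn; set d := size t in st mn *; set m := count_mem a s in mn *.
set n := count_mem b t in mn *; set x := a + b.
set p1 := split_poly (filter (predC1 a) s); set q1 := split_poly (filter (predC1 b) t).
have pE : split_poly s = ('X - a%:P) ^+ m * p1 by exact: split_poly_filter.
have qE : split_poly t = ('X - b%:P) ^+ n * q1 by exact: split_poly_filter.
have nf c (l : seq R) : c \notin filter (predC1 c) l by rewrite mem_filter /= eqxx.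
have [] := @ffconv_atom R d m n a b p1 q1.
- exact: leq_trans (count_size _ _) st.
- exact: count_size.
- exact: mn.
- by rewrite -pE size_split_poly ltnS.
- by rewrite -qE size_split_poly.
move=> h [k [k0 hx]]; rewrite -pE -qE => -> rE.
have p1a : p1.[a] != 0 by rewrite -rootE root_prod_XsubC.
have q1b : q1.[b] != 0 by rewrite -rootE root_prod_XsubC.
have h0 : h.[x] != 0 by rewrite hx !mulf_neq0 // gt_eqF.
have cE : count_mem x r = (m + n - d)%N.
  by rewrite -(mup_XsubC_exp_mul (m + n - d) h0) rE; apply/esym/mu_prod_XsubC.
split=> //; have hE : h = split_poly (filter (predC1 x) r).
  move: rE; rewrite (split_poly_filter x r) cE; apply: mulfI.
  by rewrite expf_neq0 // polyXsubC_eq0.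
have := congr1 Num.sg hx; rewrite !sgrM (gtr0_sg k0) mul1r hE /p1 /q1 !sgr_split_poly //.
rewrite !ngt_filter -exprD -[LHS]signr_odd -[RHS]signr_odd => /eqP.
rewrite -subr_eq0; case: (odd _); case: (odd _) => //=; rewrite !expr1 ?expr0.
  by rewrite -opprD oppr_eq0 (_ : 1 + 1 = 2%:R) // pnatr_eq0.
by rewrite opprK (_ : 1 + 1 = 2%:R) // pnatr_eq0.
Qed.

Lemma mup_split_poly (R : rcfType) (x : R) (s : seq R) : mup x (split_poly s) = count_mem x s.
Proof. exact: mu_prod_XsubC. Qed.

Lemma split_poly_inj (R : rcfType) (s t : seq R) : split_poly s = split_poly t -> perm_eq s t.
Proof. by move=> e; apply/allP => x _ /=; rewrite -!mup_split_poly e. Qed.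

Lemma ffconv_split (R : rcfType) (s t : seq R) : (size s <= size t)%N ->
  exists2 r, size r = size s & ffconv (size t) (split_poly s) (split_poly t) = split_poly r.
Proof.
move=> st; have [mr sr] := ffconv_split_monic st.
have [|r rE] := @split_upper_stable R (ffconv (size t) (split_poly s) (split_poly t)).
  rewrite cpoly_ffconv; apply: upper_stable_ffconv_real => //; first exact: upper_stable_split.
  by rewrite size_map_poly size_split_poly.
move: rE; rewrite (monicP mr) scale1r => rE; exists r => //.
by move: sr; rewrite rE size_split_poly => -[].
Qed.

(** * Additivity of the root counts on each side of an atom *)

(** Recentred at [a], only the term of index 0 survives: the convolution is a translation. *)
Lemma ffconv_nseq (R : rcfType) (a : R) (t : seq R) :
  ffconv (size t) (split_poly (nseq (size t) a)) (split_poly t) =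
  split_poly [seq a + y | y <- t].
Proof.
set d := size t; have sq : (size (split_poly t) <= d.+1)%N by rewrite size_split_poly.
have sp : (size (split_poly (nseq d a)) <= d.+1)%N by rewrite size_split_poly size_nseq.
rewrite ffconvC //; apply/eqP; rewrite -subr_eq0; apply/eqP/horner_all0 => z.
apply/eqP; rewrite hornerD hornerN subr_eq0; apply/eqP.
apply: (mulfI (natr_fact_neq0 R d)); rewrite (horner_ffconv_shift z a sq sp).
have -> : split_poly (nseq d a) = ('X - a%:P) ^+ d * 1.
  by rewrite /split_poly big_nseq iter_mulr_1 mulr1.
rewrite big_ord_recl big1 ?addr0; last first.
  move=> k _; rewrite horner_derivn_XsubC_exp ?leq_subr //.
  by rewrite ltn_eqF ?mulr0 //= /bump; have := ltn_ord k; lia.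
rewrite subn0 horner_derivn_XsubC_exp // eqxx hornerC mulr1 mulrC /=; congr (_ * _).
rewrite /split_poly big_map !horner_prod; apply: eq_bigr => y _.
by rewrite !hornerXsubC; ring.
Qed.

Definition counts_add (R : rcfType) (a b : R) (t s : seq R) : Prop :=
  forall r, ffconv (size t) (split_poly s) (split_poly t) = split_poly r ->
    ngt (a + b) r = (ngt a s + ngt b t)%N /\ nlt (a + b) r = (nlt a s + nlt b t)%N.

Lemma counts_add_perm (R : rcfType) (a b : R) (t s s' : seq R) :
  perm_eq s s' -> counts_add a b t s -> counts_add a b t s'.
Proof.
move=> ps h r; rewrite -(split_poly_perm ps) -(ngt_perm a ps) -(nlt_perm a ps); exact: h.
Qed.

Lemma ffconv_cons_interlace (R : rcfType) (a b c : R) (t s r w : seq R) :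
  (size s < size t)%N -> (size t <= count_mem a s + count_mem b t)%N ->
  ffconv (size t) (split_poly (c :: s)) (split_poly t) = split_poly r ->
  ffconv (size t) (split_poly s) (split_poly t) = split_poly w ->
  [/\ (ngt (a + b) r <= (ngt (a + b) w).+1)%N, (nlt (a + b) r <= (nlt (a + b) w).+1)%N,
      ((a == c) + (ngt (a + b) r + nlt (a + b) r) = (ngt (a + b) w + nlt (a + b) w).+1)%N,
      odd (ngt (a + b) r) = odd (ngt a (c :: s) + ngt b t) &
      odd (ngt (a + b) w) = odd (ngt a s + ngt b t)].
Proof.
move=> st mn rE wE.
have H : herglotz (split_poly r) (split_poly w).
  by rewrite -rE -wE; apply: ffconv_herglotz.
have sr : size r = (size s).+1.
  have [//|_] := @ffconv_split_monic R (c :: s) t.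
  by rewrite rE size_split_poly => -[].
have sw : size w = size s.
  have [|_] := @ffconv_split_monic R s t; first exact: ltnW.
  by rewrite wE size_split_poly => -[].
have [|c1 o1] := ffconv_atom_split (s := c :: s) (a := a) (b := b) st _ rE.
  by rewrite /= -addnA (leq_trans mn) // leq_addl.
have [c2 o2] := ffconv_atom_split (ltnW st) mn wE.
have [|h1 h2] := herglotz_interlace (a + b) _ H; first by rewrite sr sw.
split=> //.
have := size_trichotomy (a + b) r; have := size_trichotomy (a + b) w.
rewrite sr sw c1 c2 /= => e1 e2; rewrite [a == c]eq_sym.
by move: e1 e2 mn; case: (c == a) => /=; lia.
Qed.

(** The two counts rise by one in total and by at most one each; parity tells which side rises. *)
Lemma counts_add_cons (R : rcfType) (a b c : R) (t s : seq R) :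
  (size s < size t)%N -> (size t <= count_mem a s + count_mem b t)%N -> a != c ->
  counts_add a b t s -> counts_add a b t (c :: s).
Proof.
move=> st mn ac h r rE; have [w _ wE] := ffconv_split (ltnW st).
have [hG hL] := h w wE; have [] := ffconv_cons_interlace st mn rE wE.
rewrite (negPf ac) hG hL ngt_cons nlt_cons.
by case: (ltgtP a c) ac => //= _ _; rewrite ?add0n ?add1n ?addSn ?oddS => *; lia.
Qed.

(** Dropping a copy of [a] keeps the total of the two counts, and interlacing allows a transfer of
    at most one root, which parity excludes. *)
Lemma counts_add_behead (R : rcfType) (a b : R) (t s : seq R) :
  (size s < size t)%N -> (size t <= count_mem a s + count_mem b t)%N ->
  counts_add a b t (a :: s) -> counts_add a b t s.
Proof.
move=> st mn h w wE; have [r _ rE] := @ffconv_split R (a :: s) t st.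
have [hG hL] := h r rE; have [] := ffconv_cons_interlace st mn rE wE.
rewrite hG hL ngt_cons nlt_cons eqxx ltxx !add0n => *; lia.
Qed.

(** Starting from [size t] copies of [a], where the convolution is a translation, copies of [a] are
    removed until [count_mem a s] are left, then the other roots of [s] are added. The inequality on
    multiplicities holds all along. *)
Lemma ffconv_counts (R : rcfType) (a b : R) (s t : seq R) :
  (size s <= size t)%N -> (size t <= count_mem a s + count_mem b t)%N -> counts_add a b t s.
Proof.
move=> st mn.
have base j : (size t <= size t - j + count_mem b t)%N -> counts_add a b t (nseq (size t - j) a).
  elim: j => [_ r|j IH jt].
    rewrite subn0 ffconv_nseq => /split_poly_inj pr.
    rewrite -(ngt_perm _ pr) -(nlt_perm _ pr) /ngt /nlt !count_map !count_nseq ltxx.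
    by split; apply: eq_count => y /=; rewrite ltrD2l.
  have [tj|jt'] := leqP (size t) j.
    by rewrite (_ : size t - j.+1 = size t - j)%N; [apply: IH|]; lia.
  apply: counts_add_behead; rewrite ?size_nseq ?count_nseq /= ?eqxx ?mul1n //; first by lia.
  rewrite -[a :: _]/(nseq (size t - j.+1).+1 a) -subSn // subSS.
  by apply: IH; lia.
have ps : perm_eq (filter (predC1 a) s ++ nseq (count_mem a s) a) s.
  have <- : filter (pred1 a) s = nseq (count_mem a s) a.
    rewrite -size_filter; apply/all_pred1P/allP => x.
    by rewrite mem_filter => /andP[].
  by rewrite perm_catC perm_filterC.
apply: (counts_add_perm ps).
have cs : (count_mem a s <= size t)%N by apply: leq_trans (count_size _ _) st.
have na : {in filter (predC1 a) s, forall c, a != c}.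
  by move=> c; rewrite mem_filter /= eq_sym => /andP[].
have sz : (size (filter (predC1 a) s) + count_mem a s <= size t)%N.
  by rewrite -(perm_size ps) size_cat size_nseq in st.
elim: (filter (predC1 a) s) na sz => [|c l IH] na sz /=.
  have := base (size t - count_mem a s)%N; rewrite subKn //; exact.
have cl : (count_mem a s <= count_mem a (l ++ nseq (count_mem a s) a))%N.
  by rewrite count_cat count_nseq /= eqxx mul1n leq_addl.
apply: counts_add_cons.
- by rewrite size_cat size_nseq.
- by rewrite (leq_trans mn) // leq_add2r.
- by apply: na; rewrite mem_head.
- by apply: IH => [x xl|]; [apply: na; rewrite inE xl orbT|apply: ltnW].
Qed.

Lemma sum_count_mem (T : eqType) (P : pred T) (u s : seq T) : uniq u -> {subset s <= u} ->
  \sum_(y <- u | P y) count_mem y s = count P s.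
Proof.
move=> uu; elim: s => [|c s IH] su /=; first by rewrite big1.
rewrite big_split /= IH => [|y ys]; last by apply: su; rewrite inE ys orbT.
congr addn; rewrite big_mkcond (bigD1_seq c) ?su ?mem_head //= eqxx big1 ?addn0 => [|y yc].
  by case: (P c).
by rewrite eq_sym (negPf yc); case: (P y).
Qed.

(** * Empirical distributions and conclusion *)

Lemma emp_atom_split (R : rcfType) (s : seq R) (x : R) :
  emp_atom (split_poly s) x = (count_mem x s)%:R / (size s)%:R.
Proof. by rewrite /emp_atom /degp mup_split_poly size_split_poly. Qed.

Lemma emp_cdf_split (R : rcfType) (s : seq R) (x : R) :
  emp_cdf (split_poly s) x = (count_mem x s + nlt x s)%:R / (size s)%:R.
Proof.
rewrite /emp_cdf /degp size_split_poly; congr (_%:R / _).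
under eq_bigr => y _ do rewrite mup_split_poly.
rewrite sum_count_mem ?uniq_roots //; last first.
  move=> y ys; rewrite -roots_on_rootsR ?monic_neq0 ?split_poly_monic //.
  by rewrite root_prod_XsubC.
rewrite /nlt; elim: (s) => //= y l ->.
by case: (ltgtP y x) => _ /=; lia.
Qed.

Theorem theorem1p1 (R : rcfType) (d : nat) (p q : {poly R}) :
  realrooted_monic d p -> realrooted_monic d q ->
  (forall z : R[i],
      root (map_poly (real_complex R) (boxplus d p q)) z ->
      ~ trivial_root d p q z ->
      mup z (map_poly (real_complex R) (boxplus d p q)) = 1%N) /\
  (forall a b : R, atom_triplet d p q a b ->
      emp_atom (boxplus d p q) (a + b) = emp_atom p a + emp_atom q b - 1 /\
      emp_cdf (boxplus d p q) (a + b) = emp_cdf p a + emp_cdf q b - 1).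
Proof.
move=> [s [ss ->]] [t [st ->]]; rewrite -!/(split_poly _).
rewrite boxplusE ?size_split_poly ?ss // -st; rewrite -st in ss.
have [|r sr rE] := @ffconv_split R s t; first by rewrite ss.
split=> [z | a b]; rewrite rE.
  rewrite -/(cpoly _) cpoly_split root_prod_XsubC mu_prod_XsubC => /mapP[y yr ->] triv.
  rewrite count_map (eq_count (a2 := pred1 y)); last first.
    by move=> x; rewrite /= (inj_eq (@complexI R)).
  (* All complex roots are real here, so a multiplicity above one would make [y] a trivial root. *)
  apply/eqP; rewrite eqn_leq andbC -has_count has_pred1 yr /= leqNgt; apply/negP => yr2.
  case: triv; have [|a [b [as_ bt -> mn]]] := ffconv_double_root (x := y) ss.
    by rewrite rE mup_split_poly.
  by exists a, b; rewrite /atom_triplet !root_prod_XsubC !mup_split_poly.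
rewrite /atom_triplet !mup_split_poly => -[as_ [bt mn]].
have st' : (size s <= size t)%N by rewrite ss.
have [cx _] := ffconv_atom_split st' (ltnW mn) rE.
have [_ lx] := ffconv_counts st' (ltnW mn) rE.
(* The degree is nonzero because [q] has the root [b], so the counts can be divided by it. *)
have t0 : (size t)%:R != 0 :> R.
  by rewrite pnatr_eq0 size_eq0; apply: contraTneq bt => ->; rewrite root_prod_XsubC.
rewrite !emp_atom_split !emp_cdf_split cx lx sr ss.
split; first by rewrite natrB ?(ltnW mn) // natrD; field.
by rewrite natrD natrB ?(ltnW mn) // !natrD; field.
Qed.
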